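(* Let $k,m$ be integers with $0\le k\le m$ and $m\geq 1$. (i) If $m\ge2$ then $L_{0,m}^{Q}\subset Q_{m+2}(\sqrt2)$ is displaceable. (ii) If $k+m\ge3$ then $L_{k,m}^{P}\subset\mathbb{C}P^{k+m+1}(\sqrt2)$ is displaceable.
   Context: $\mathbb{C}P^N(\sqrt2)$ is $\mathbb{C}P^N$ with the symplectic form obtained by coisotropic reduction of the sphere of radius $\sqrt2$ in $\mathbb{C}^{N+1}$; homogeneous coordinates are normalized by $\sum|z_j|^2=2$. $Q_N(\sqrt2)=\{\sum z_j^2=0\}\subset\mathbb{C}P^N(\sqrt2)$ with the restricted form. A subset $L$ of a symplectic manifold $M$ is displaceable if $\phi(L)\cap L=\varnothing$ for some Hamiltonian diffeomorphism $\phi$ of $M$. $T^*S^n=\{(p,q)\in\mathbb{R}^{n+1}\times\mathbb{R}^{n+1}:p\cdot q=0,|q|=1\}$; $T^*\mathbb{R}P^n=T^*S^n/((p,q)\sim(-p,-q))$; $D_1^*$ denotes $|p|<1$; $S^0=\{\pm1\}$. For $r>0$, $\mathcal{P}_{k,m}^r\subset T^*S^{k+m+1}$ is the image of $S^1\times S^k\times S^m\ni(e^{i\theta},x,y)\mapsto\big((-r\sin\theta\,x,\ r\cos\theta\,y),(\cos\theta\,x,\ \sin\theta\,y)\big)$, where $S^k\subset\mathbb{R}^{k+1}$, $S^m\subset\mathbb{R}^{m+1}$, and $\underline{\mathcal{P}}_{k,m}^r$ is its image in $T^*\mathbb{R}P^{k+m+1}$. $\Psi\colon D_1^*S^{k+m+1}\to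 Q_{k+m+2}(\sqrt2)$ is $\Psi(p,q)=[\sqrt{1-|p|^2}:p+iq]$, and $\Psi^P\colon D_1^*\mathbb{R}P^{k+m+1}\to\mathbb{C}P^{k+m+1}(\sqrt2)$ is $\Psi^P([(p,q)])=\left[\sqrt{f(|p|)}\,p+\frac{i}{\sqrt{f(|p|)}}q\right]$ with $f(x)=\frac{1-\sqrt{1-x^2}}{x^2}$, $f(0)=\frac12$. The (monotone Lagrangian) submanifolds in question are $$L_{k,m}^Q=\Psi\left(\mathcal{P}_{k,m}^{1-\frac{1}{k+m+1}}\right),\qquad L_{k,m}^P=\Psi^P\left(\underline{\mathcal{P}}_{k,m}^{1-\frac{2}{k+m+2}}\right).$$ *)

(* Defs.v *)
From HB Require Import structures.
From mathcomp Require Import all_boot all_order all_algebra generic_quotient.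
From mathcomp Require Import complex.
From mathcomp Require Import all_classical all_reals all_analysis.

Set Implicit Arguments.
Unset Strict Implicit.
Unset Printing Implicit Defensive.

Import Order.TTheory GRing.Theory Num.Theory.
Import numFieldNormedType.Exports.

Local Open Scope classical_set_scope.
Local Open Scope ring_scope.
Local Open Scope complex_scope.
Local Open Scope quotient_scope.

Section Smooth.
Context {R : realType} {V : normedModType R}.

(* For finite-dimensional V and open U, this is the class C^r on U: all iterated
   directional derivatives up to order r exist and are continuous on U. *)
Fixpoint of_class (r : nat) (U : set V) (f : V -> R) : Prop :=
  match r with
  | 0%N => forall x, U x -> {for x, continuous f}
  | r'.+1 => (forall x v, U x -> derivable f x v) /\
             (forall v, of_class r' U ('D_v f))
  end.

Definition smooth_on (A : set V) (f : V -> R) : Prop :=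
  forall a, A a -> exists (U : set V) (g : V -> R),
    [/\ open U, U a, forall r, of_class r U g
      & forall x, A x -> U x -> f x = g x].

End Smooth.

Section Euclidean.
Context {R : realType}.

Definition dot {n} (u v : 'rV[R]_n) : R := \sum_(j < n) u 0 j * v 0 j.

(* the Euclidean norm; the library norm on row vectors is the sup norm *)
Definition enorm {n} (u : 'rV[R]_n) : R := Num.sqrt (dot u u).

Definition usphere n : set 'rV[R]_n.+1 := [set u | enorm u = 1].

End Euclidean.

Section Projective.
Context {R : realType}.

(* The real normed space underlying C^n: the pair (x, y) stands for x + i y. *)
Definition realC n : normedModType R := ('rV[R]_n * 'rV[R]_n)%type.

Definition cvec {n} (u : realC n) : 'rV[R[i]]_n :=
  \row_j (u.1 0 j +i* u.2 0 j).

(* [omega0] is the standard form sum_j dx_j /\ dy_j on C^n. *)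
Definition omega0 {n} (u v : realC n) : R := dot u.1 v.2 - dot u.2 v.1.

(* A point of projective space is a complex line through 0; [hpt z] is the point
   with homogeneous coordinates z. *)
Definition hpt {n} (z : 'rV[R[i]]_n) : set 'rV[R[i]]_n :=
  [set a *: z | a in [set: R[i]]].

Definition CP N : set (set 'rV[R[i]]_N.+1) := [set hpt z | z in [set z : 'rV[R[i]]_N.+1 | z != 0]].

Definition quadric N : set (set 'rV[R[i]]_N.+1) :=
  [set hpt z | z in [set z : 'rV[R[i]]_N.+1 | z != 0 /\ \sum_j z 0 j ^+ 2 = 0]].

End Projective.

Arguments usphere : clear implicits.
Arguments realC : clear implicits.
Arguments CP : clear implicits.
Arguments quadric : clear implicits.

Section Hamiltonian.
Context {R : realType} {N : nat}.
Implicit Types (M L : set (set 'rV[R[i]]_N.+1)) (c : R -> realC R N.+1).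

(* The part lying over M of the sphere of radius sqrt 2. For a submanifold M of
   CP^N, the projection [sphere_over M -> M], u |-> hpt (cvec u), is the circle bundle
   of the coisotropic reduction. The manifold structure of M is the quotient
   one, and its symplectic form omega_M (reduced form restricted to M) is
   determined by: its pullback to [sphere_over M] is the restriction of omega0. *)
Definition sphere_over M : set (realC R N.+1) :=
  [set u | dot u.1 u.1 + dot u.2 u.2 = 2 /\ M (hpt (cvec u))].

Definition smooth_hamiltonian M (H : R -> set 'rV[R[i]]_N.+1 -> R) : Prop :=
  smooth_on (V := (R * realC R N.+1)%type) (`[0, 1]%classic `*` sphere_over M)
    (fun tu => H tu.1 (hpt (cvec tu.2))).

(* [c] restricted to [0, 1] is a lift of an integral curve of the Hamiltonian
   vector field X_{H_t} of M, given by omega_M (X_{H_t}, _) = d H_t. Tangent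
   vectors of [sphere_over M] are represented by the curves g in [sphere_over M]. *)
Definition hamiltonian_curve M (H : R -> set 'rV[R[i]]_N.+1 -> R) c : Prop :=
  forall t, 0 <= t <= 1 ->
    [/\ sphere_over M (c t), derivable c t 1
      & forall g : R -> realC R N.+1,
          (forall s, sphere_over M (g s)) -> g 0 = c t -> derivable g 0 1 ->
          is_derive (0 : R) (1 : R) (fun s => H t (hpt (cvec (g s))))
            (omega0 ('D_1 c t) ('D_1 g 0))].

(* Time-one maps of the flows of smooth time-dependent Hamiltonians; such a map
   of a compact M is automatically a diffeomorphism of M. Values of [phi]
   outside M are irrelevant. *)
Definition hamiltonian_diffeo M
    (phi : set 'rV[R[i]]_N.+1 -> set 'rV[R[i]]_N.+1) : Prop :=
  exists2 H, smooth_hamiltonian M H &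
    forall P, M P -> exists c,
      [/\ hamiltonian_curve M H c, hpt (cvec (c 0)) = P
        & hpt (cvec (c 1)) = phi P].

Definition displaceable M L : Prop :=
  L `<=` M /\
  exists2 phi, hamiltonian_diffeo M phi & phi @` L `&` L = set0.

End Hamiltonian.

Section Lagrangians.
Context {R : realType}.

(* T^*S^d sits in the space of pairs (p, q), and T^*RP^d in the quotient of
   that space by (p, q) ~ (-p, -q). *)
Definition cotangent n : zmodType := ('rV[R]_n * 'rV[R]_n)%type.

Definition antipodal {n} (a b : cotangent n) : bool := (a == b) || (a == - b).

Lemma antipodal_equiv n : equiv_class_of (@antipodal n).
Proof.
split=> [a|a b|b a c]; rewrite /antipodal ?eqxx//.
  by rewrite [b == a]eq_sym [b == - a]eq_sym eqr_oppLR.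
by case/orP=> /eqP-> /orP[] /eqP->; rewrite ?opprK eqxx ?orbT.
Qed.

Canonical antipodal_rel n := EquivRelPack (@antipodal_equiv n).

Definition cotangentP n : Type := {eq_quot @antipodal_rel n}.
HB.instance Definition _ n := Quotient.on (cotangentP n).

Definition calP k m (r : R) : set (cotangent (k.+1 + m.+1)) :=
  [set pq | exists theta x y, [/\ usphere R k x, usphere R m y &
    pq = (row_mx (- r * sin theta *: x) (r * cos theta *: y),
          row_mx (cos theta *: x) (sin theta *: y))]].
Arguments calP : clear implicits.

Definition ucalP k m (r : R) : set (cotangentP (k.+1 + m.+1)) :=
  [set \pi_(cotangentP _) pq | pq in calP k m r].
Arguments ucalP : clear implicits.

Definition Psi {n} (a : cotangent n) : set 'rV[R[i]]_(1 + n) :=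
  hpt (row_mx (Num.sqrt (1 - enorm a.1 ^+ 2))%:C%:M (cvec a)).

Definition fP (x : R) : R :=
  if x == 0 then 2^-1 else (1 - Num.sqrt (1 - x ^+ 2)) / x ^+ 2.

Definition PsiP_rep {n} (a : cotangent n) : set 'rV[R[i]]_n :=
  let s := Num.sqrt (fP (enorm a.1)) in
  hpt (cvec (s *: a.1, s^-1 *: a.2)).

Definition PsiP {n} (a : cotangentP n) : set 'rV[R[i]]_n := PsiP_rep (repr a).

Lemma PsiP_pi n (a : cotangent n) : PsiP (\pi_(cotangentP n) a) = PsiP_rep a.
Proof.
rewrite /PsiP; case: piP => b /eqmodP /orP[] /eqP-> //; rewrite /PsiP_rep /=.
have -> : enorm (- b.1) = enorm b.1.
  by congr Num.sqrt; apply: eq_bigr => j _; rewrite !mxE mulrNN.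
set s := Num.sqrt _.
have -> : cvec (s *: - b.1, s^-1 *: - b.2) = - cvec (s *: b.1, s^-1 *: b.2).
  by apply/rowP => j; rewrite !mxE /= !mulrN.
apply/seteqP; split=> _ [a0 _ <-]; exists (- a0) => //.
  by rewrite scalerN scaleNr opprK.
by rewrite scalerN scaleNr.
Qed.

Definition LQ k m : set (set 'rV[R[i]]_(1 + (k.+1 + m.+1))) :=
  Psi @` calP k m (1 - (k + m + 1)%:R^-1).

Definition LP k m : set (set 'rV[R[i]]_(k.+1 + m.+1)) :=
  PsiP @` ucalP k m (1 - 2 / (k + m + 2)%:R).

End Lagrangians.

Arguments LQ : clear implicits.
Arguments LP : clear implicits.
Arguments calP : clear implicits.
Arguments ucalP : clear implicits.

(* Main.v *)
Require Import Defs.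
From HB Require Import structures.
From mathcomp Require Import all_boot all_order all_algebra.
From mathcomp Require Import all_classical all_reals all_analysis.
From mathcomp Require Import ring lra zify complex.

Set Implicit Arguments.
Unset Strict Implicit.
Unset Printing Implicit Defensive.

Import Order.TTheory GRing.Theory Num.Theory.
Import numFieldNormedType.Exports.

Local Open Scope classical_set_scope.
Local Open Scope ring_scope.
Local Open Scope complex_scope.

(** Both Lagrangians project to a pair of circles on a round sphere. For [LP],
reducing CP^(k+m+1) by SO(k+1) x SO(m+1) gives CP^1 modulo [u : v] ~ [u : -v],
and for [LQ] reducing the quadric by SO(m+1) gives the unit sphere of normals of
oriented planes in R^3, modulo a half-turn. In both cases one can choose
coordinates (n0, n1, n2) in which the half-turn is about the n2-axis and the
Lagrangian lies over |n0| = r, the boundary of two antipodal caps which, by the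
hypotheses on k and m, together have less than half of the area of the sphere.

The quarter-turn about the n2-axis is induced by a one-parameter group of
unitary maps, but it moves the caps off themselves only if r > 1/sqrt 2. Hence we
first twist the sphere around the n1-axis, rotating the circle at height n1 by
the angle 2 arctan (n1/2). This commutes with the half-turn, lifts to an explicit
symplectomorphism Psi of the whole manifold, and makes the image of the caps
disjoint from its quarter-turn as soon as r >= 3/5. So Psi^-1 o R_t o Psi, with
R_t the rotation group and with Hamiltonian the one of R_t composed with Psi,
displaces the Lagrangian. *)

(** * Disjointness of the twisted caps from their quarter-turn *)

(* For [p = a * b], [q = a ^+ 2 + b ^+ 2] and [rho = r ^+ 2], eliminating [c] from
   the equations of [caps_disjoint_pos] below gives two equations linear in [rho].
   This combines them at [rho = 9 / 25]; the multiplier [3 / 2 - 5 / 2 * p] is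
   chosen so that the quadratic polynomial in [q] has negative discriminant. *)
Lemma caps_eliminant_lt0 (R : realFieldType) (p q : R) :
  - 1 <= 2 * p -> 2 * p <= 1 ->
  (8 * q - 4 * p ^+ 2) * (16 - p * q + p ^+ 2)
    - (4 + p) * (16 * q ^+ 2 - 16 * p ^+ 2 + p ^+ 2 * q)
    - 9 / 25 * ((4 + p) * (32 + 8 * q + q ^+ 2 - 2 * p ^+ 2))
    - (3 / 2 - 5 / 2 * p) *
      ((4 * q - 2 * p ^+ 2) ^+ 2 - 9 / 25 * ((4 + p) ^+ 2 * (q + 2 * p))) < 0.
Proof.
move=> h1 h2; set G := (X in X < 0).
pose al := 8 * p + 16 * (4 + p) + 9 / 25 * (4 + p) + 16 * (3 / 2 - 5 / 2 * p).
pose be := 8 * (16 + p ^+ 2) + 4 * p ^+ 3 - (4 + p) * p ^+ 2 - 9 / 25 * 8 * (4 + p)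
  + (3 / 2 - 5 / 2 * p) * (16 * p ^+ 2 + 9 / 25 * (4 + p) ^+ 2).
pose ga := - 4 * p ^+ 2 * (16 + p ^+ 2) + 16 * p ^+ 2 * (4 + p)
  - 9 / 25 * (4 + p) * (32 - 2 * p ^+ 2)
  - (3 / 2 - 5 / 2 * p) * (4 * p ^+ 4 - 9 / 25 * (4 + p) ^+ 2 * 2 * p).
have al0 : 0 < al by rewrite /al; lra.
have GE : G = - al * q ^+ 2 + be * q + ga by rewrite /G /al /be /ga; ring.
have disc : be ^+ 2 + 4 * al * ga < 0.
  (* The discriminant has degree 6 in [p]. The products below are nonnegative for |p| <= 1/2 and
     serve to certify its negativity. *)
  rewrite /al /be /ga.
  have p2 : 0 <= 1 / 4 - p ^+ 2.
    by have : 0 <= (1 - 2 * p) * (1 + 2 * p) by [apply: mulr_ge0; lra]; lra.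
  have p20 := sqr_ge0 p.
  have p4 : 0 <= p ^+ 2 * (1 / 4 - p ^+ 2) by apply: mulr_ge0.
  have p40 : 0 <= p ^+ 4 by rewrite (exprM p 2 2) sqr_ge0.
  have p6 : 0 <= p ^+ 4 * (1 / 4 - p ^+ 2) by apply: mulr_ge0.
  have p5 : 0 <= p ^+ 4 * (p - 1) ^+ 2 by apply: mulr_ge0; rewrite ?sqr_ge0.
  have p3 : 0 <= (p + 1 / 2) * (2 * p - 7 / 10) ^+ 2.
    by apply: mulr_ge0; rewrite ?sqr_ge0; lra.
  nra.
have : 4 * al * G = - (2 * al * q - be) ^+ 2 + (be ^+ 2 + 4 * al * ga).
  by rewrite GE; ring.
have := sqr_ge0 (2 * al * q - be); nra.
Qed.

(** The sum of [a] times the first equation and [b] times the second is free of [c]; solved for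
    [4 b c] and [4 a c] and squared, they add up to an equation containing only [c^2 = 1 - q].
    Removing [s = a + b] leaves two equations linear in [r^2], to which the eliminant applies. *)
Lemma caps_disjoint_pos (R : realFieldType) (a b c r : R) :
  a ^+ 2 + b ^+ 2 + c ^+ 2 = 1 -> 3 / 5 <= r ->
  (4 - b ^+ 2) * a + 4 * b * c = r * (4 + b ^+ 2) ->
  (4 - a ^+ 2) * b - 4 * a * c = r * (4 + a ^+ 2) -> False.
Proof.
move=> abc hr F G.
pose p := a * b; pose q := a ^+ 2 + b ^+ 2; pose s := a + b.
have E1 : r * (4 + p) * s = 4 * q - 2 * p ^+ 2.
  have := congr1 (fun x => a * x) F; have := congr1 (fun x => b * x) G.
  by rewrite /p /q /s; lra.
have s2 : s ^+ 2 = q + 2 * p by rewrite /s /p /q; ring.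
have cE : c ^+ 2 = 1 - q by rewrite -abc /q; ring.
have E2 : r ^+ 2 * (32 + 8 * q + q ^+ 2 - 2 * p ^+ 2)
     - 2 * (r * s) * (16 - p * q + p ^+ 2) + 16 * (q ^+ 2 - p ^+ 2) + p ^+ 2 * q = 0.
  have hF : 4 * b * c = r * (4 + b ^+ 2) - (4 - b ^+ 2) * a by rewrite -F; ring.
  have hG : 4 * a * c = (4 - a ^+ 2) * b - r * (4 + a ^+ 2) by rewrite -G; ring.
  have : (4 * b * c) ^+ 2 + (4 * a * c) ^+ 2 = 16 * q * (1 - q).
    by rewrite -cE /q; ring.
  by rewrite hF hG /q /p /s; lra.
have p1 : - 1 <= 2 * p by have := sqr_ge0 (a + b); have := sqr_ge0 c; rewrite /p; lra.
have p2 : 2 * p <= 1 by have := sqr_ge0 (a - b); have := sqr_ge0 c; rewrite /p; lra.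
have q1 : 0 <= q by rewrite addr_ge0 ?sqr_ge0.
have E1' : (4 * q - 2 * p ^+ 2) ^+ 2 = r ^+ 2 * ((4 + p) ^+ 2 * (q + 2 * p)).
  by rewrite -E1 -s2; ring.
(* Multiplying [E2] by [4 + p] lets [E1] replace the remaining factor [r * s]. *)
have E2' : (8 * q - 4 * p ^+ 2) * (16 - p * q + p ^+ 2)
    - (4 + p) * (16 * q ^+ 2 - 16 * p ^+ 2 + p ^+ 2 * q)
    = r ^+ 2 * ((4 + p) * (32 + 8 * q + q ^+ 2 - 2 * p ^+ 2)).
  have -> : 8 * q - 4 * p ^+ 2 = 2 * (r * (4 + p) * s) by rewrite E1; ring.
  by have := congr1 (fun x => (4 + p) * x) E2; lra.
have := caps_eliminant_lt0 q p1 p2.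
rewrite E1' E2'.
have r2 : 0 <= r ^+ 2 - 9 / 25 by nra.
(* As a function of rho, the combination of the two equations has slope minus this product. Being
   nonincreasing and negative at 9/25, it cannot vanish at [r ^+ 2]. *)
have : 0 <= (4 + p) * ((32 + 8 * q + q ^+ 2 - 2 * p ^+ 2)
    - (3 / 2 - 5 / 2 * p) * ((4 + p) * (q + 2 * p))).
  apply: mulr_ge0; first lra.
  have q2 : 0 <= 1 - q by rewrite -cE sqr_ge0.
  have P : 0 <= p + 1 / 2 by lra.
  have := mulr_ge0 q1 P; have := mulr_ge0 P (sqr_ge0 p); have := mulr_ge0 (sqr_ge0 p) q1.
  by have := sqr_ge0 q; have := sqr_ge0 p; clear -p1 p2 q1 q2; lra.
move=> h; have := mulr_ge0 r2 h; lra.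
Qed.

(* On the unit sphere with coordinates (a, b, c), the first expression divided by
   [4 + b ^+ 2] is the coordinate n0 of the point before the twist, and the second
   one is the same for the point moved by the quarter-turn. *)
Lemma caps_disjoint (R : realFieldType) (a b c r : R) :
  a ^+ 2 + b ^+ 2 + c ^+ 2 = 1 -> 3 / 5 <= r ->
  ((4 - b ^+ 2) * a + 4 * b * c) ^+ 2 = (r * (4 + b ^+ 2)) ^+ 2 ->
  ((4 - a ^+ 2) * b - 4 * a * c) ^+ 2 = (r * (4 + a ^+ 2)) ^+ 2 -> False.
Proof.
(* The half-turns about the three coordinate axes carry the other choices of signs to the positive
   one. *)
move=> abc hr /eqP; rewrite eqf_sqr => /orP[] /eqP F /eqP; rewrite eqf_sqr => /orP[] /eqP G.
- exact: (caps_disjoint_pos abc hr F G).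
- by apply: (@caps_disjoint_pos R a (- b) (- c) r); rewrite ?sqrrN //; lra.
- by apply: (@caps_disjoint_pos R (- a) b (- c) r); rewrite ?sqrrN //; lra.
- by apply: (@caps_disjoint_pos R (- a) (- b) c r); rewrite ?sqrrN //; lra.
Qed.

(** * Smooth functions and differentiable curves *)

Section Elementary.
Context {R : realType}.

(** Restriction to the line through [x] in the direction [v] reduces this to the chain rule in one
    variable. *)
Lemma is_derive_comp1 (V : normedModType R) (f : V -> R) (g : R -> R) x v df dg :
  is_derive x v f df -> is_derive (f x) 1 g dg ->
  is_derive x v (fun y => g (f y)) (dg * df).
Proof.
move=> hf hg.
have lineE (h : V -> R) : 'D_v h x = 'D_1 (fun s : R => h (s *: v + x)) 0.
  rewrite /derive; set g1 := fun s => s^-1 *: _; set g2 := fun s => s^-1 *: _.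
  suff -> : g1 = g2 by [].
  rewrite /g1 /g2; apply/funext => s /=.
  by rewrite scale0r add0r addr0 [_%:A]mulr1.
have hl : is_derive (0 : R) (1 : R) (fun s : R => f (s *: v + x)) df.
  apply: DeriveDef; first by apply: (derivable1P f x v).1; exact: ex_derive.
  by rewrite -lineE derive_val.
have hg' : is_derive (f ((0 : R) *: v + x)) 1 g dg by rewrite scale0r add0r.
have hc := @is_derive1_comp _ g (fun s : R => f (s *: v + x)) 0 dg df hg' hl.
apply: DeriveDef; first by apply: (derivable1P _ x v).2; exact: (@ex_derive _ _ _ _ _ _ _ hc).
by rewrite lineE -(@derive_val _ _ _ _ _ _ _ hc).
Qed.

Lemma is_derive_rsqrt (V : normedModType R) (f : V -> R) x v df :
  0 < f x -> is_derive x v f df ->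
  is_derive x v (fun y => (Num.sqrt (f y))^-1)
    (- 2^-1 * (Num.sqrt (f x))^-1 ^+ 3 * df).
Proof.
move=> fx0 hf; apply: (@is_derive_comp1 _ f (fun y => (Num.sqrt y)^-1) _ _ _ _ hf).
have s0 : Num.sqrt (f x) != 0 by rewrite gt_eqF // sqrtr_gt0.
have hs : is_derive (f x) 1 Num.sqrt (2 * Num.sqrt (f x))^-1.
  exact: is_derive1_sqrt.
apply: DeriveDef; first by apply: derivableV => //; exact: (@ex_derive _ _ _ _ _ _ _ hs).
rewrite deriveV //.
rewrite (@derive_val _ _ _ _ _ _ _ hs) /GRing.scale /=; field.
by rewrite s0.
Qed.

(* Closed under directional derivatives, hence consisting of smooth functions;
   inverses of positive functions are squares of inverse square roots. *)
Inductive elementary (V : normedModType R) : (V -> R) -> Prop :=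
| elementary_linear (f : {linear V -> R}) : continuous f -> elementary f
| elementary_cst c : elementary (fun=> c)
| elementaryD f g : elementary f -> elementary g -> elementary (fun x => f x + g x)
| elementaryM f g : elementary f -> elementary g -> elementary (fun x => f x * g x)
| elementary_rsqrt f : (forall x, 0 < f x) -> elementary f ->
    elementary (fun x => (Num.sqrt (f x))^-1).

Variable V : normedModType R.
Implicit Types f g : V -> R.

Lemma elementary_scalar f : (forall a x y, f (a *: x + y) = a * f x + f y) ->
  continuous f -> elementary f.
Proof.
move=> fl fc; pose fM := GRing.isLinear.Build R V R _ f fl.
pose fL : {linear V -> R} := HB.pack f fM.
exact: (@elementary_linear V fL).
Qed.

Lemma elementaryN f : elementary f -> elementary (fun x => - f x).
Proof.
move=> hf; rewrite (_ : (fun x => _) = (fun x => -1 * f x)).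
  by apply: elementaryM => //; exact: elementary_cst.
by apply/funext => x; rewrite mulN1r.
Qed.

Lemma elementaryB f g : elementary f -> elementary g -> elementary (fun x => f x - g x).
Proof. by move=> hf hg; apply: elementaryD => //; exact: elementaryN. Qed.

(** Induction on the construction of [f]: the derivative of each constructor is built from the same
    constructors, that of an inverse square root [w] of [f] being [- w^3 f' / 2]. Differentiation
    can therefore be iterated. *)
Lemma elementary_derive f : elementary f ->
  continuous f /\ forall v, exists2 f', elementary f' & forall x, is_derive x v f (f' x).
Proof.
elim=> {f} [f cf|c|f g _ [cf df] _ [cg dg]|f g ef [cf df] eg [cg dg]|f f0 ef [cf df]].
- split=> // v; exists (fun=> f v); first exact: elementary_cst.
  move=> x; have hd : differentiable f x by exact: linear_differentiable.
  apply: DeriveDef; first exact: diff_derivable.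
  by rewrite deriveE // diff_lin.
- split; first by move=> x; exact: cvg_cst.
  move=> v; exists (fun=> 0); first exact: elementary_cst.
  by move=> x; exact: is_derive_cst.
- split; first by move=> x; apply: cvgD; [exact: cf|exact: cg].
  move=> v; have [f' ef' hf'] := df v; have [g' eg' hg'] := dg v.
  exists (fun x => f' x + g' x); first exact: elementaryD.
  by move=> x; apply: is_deriveD.
- split; first by move=> x; apply: cvgM; [exact: cf|exact: cg].
  move=> v; have [f' ef' hf'] := df v; have [g' eg' hg'] := dg v.
  exists (fun x => f x * g' x + g x * f' x).
    by apply: elementaryD; apply: elementaryM.
  by move=> x; apply: is_deriveM.
- have s0 x : Num.sqrt (f x) != 0 by rewrite gt_eqF // sqrtr_gt0.
  split.
    move=> x; apply: cvgV => //.
    by apply: (@continuous_comp _ _ _ f Num.sqrt); [exact: cf|exact: sqrt_continuous].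
  move=> v; have [f' ef' hf'] := df v.
  have er := elementary_rsqrt f0 ef.
  exists (fun x => (- 2^-1) * (((Num.sqrt (f x))^-1 * ((Num.sqrt (f x))^-1 * (Num.sqrt (f x))^-1)) * f' x)).
    apply: elementaryM; first exact: elementary_cst.
    by apply: elementaryM => //; do 2 apply: elementaryM => //.
  by move=> x; apply: is_derive_eq (is_derive_rsqrt (f0 x) (hf' x)) _; rewrite !exprS expr0; ring.
Qed.

Lemma elementary_of_class f r (U : set V) : elementary f -> of_class r U f.
Proof.
elim: r f => [|r IH] f ef; first by move=> x _; exact: (elementary_derive ef).1.
have [_ df] := elementary_derive ef.
split=> [x v _|v]; first by have [f' _ h] := df v; exact: ex_derive.
have [f' ef' h] := df v; rewrite (_ : 'D_v f = f'); first exact: IH.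
by apply/funext => x; exact: derive_val.
Qed.

Lemma elementary_smooth_on f (A : set V) : elementary f -> smooth_on A f.
Proof.
move=> ef a Aa; exists setT, f; split=> //; first exact: openT.
by move=> r; exact: elementary_of_class.
Qed.

End Elementary.

Section Curves.
Context {R : realType}.

Lemma is_derive_bigsum (V : normedModType R) (I : Type) (r : seq I) (P : pred I)
    (f : I -> V -> R) (x v : V) (df : I -> R) :
  (forall i, is_derive x v (f i) (df i)) ->
  is_derive x v (fun y => \sum_(i <- r | P i) f i y) (\sum_(i <- r | P i) df i).
Proof.
move=> hf; elim: r => [|i r IH].
  rewrite big_nil (_ : (fun y => _) = cst 0); first exact: is_derive_cst.
  by apply/funext => y; rewrite big_nil.
rewrite big_cons; case Pi : (P i).
  rewrite (_ : (fun y => _) = f i + (fun y => \sum_(i <- r | P i) f i y)).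
    exact: is_deriveD.
  by apply/funext => y; rewrite big_cons Pi.
rewrite (_ : (fun y => _) = (fun y => \sum_(i <- r | P i) f i y)) //.
by apply/funext => y; rewrite big_cons Pi.
Qed.

Variable n : nat.
Implicit Types (g : R -> realC R n) (u v : realC R n) (t : R).

(** Working by coordinates lets explicit formulas be differentiated with the scalar rules;
    [derivable_coords] and [is_derive_coords] translate from and to the normed space. *)
Definition deriv_coords g t v :=
  forall j, is_derive t 1 (fun s => (g s).1 0 j) (v.1 0 j) /\
            is_derive t 1 (fun s => (g s).2 0 j) (v.2 0 j).

Lemma derivable_fst (V W : normedModType R) (g : R -> V * W) t :
  derivable g t 1 -> derivable (fun s => (g s).1) t 1 /\ 'D_1 (fun s => (g s).1) t = ('D_1 g t).1.
Proof.
move=> /cvg_ex[l hl].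
have h1 : (fun h : R => h^-1 *: ((g (h *: 1 + t)).1 - (g t).1)) x @[x --> 0^'] --> l.1.
  apply: (@cvg_comp _ _ _ (fun h : R => h^-1 *: (g (h *: 1 + t) - g t)) fst _ _ _ hl).
  by case: (l) => a b; exact: cvg_fst.
split; first by apply/cvg_ex; exists l.1.
rewrite /derive (cvg_lim _ h1) //.
by rewrite (cvg_lim _ hl).
Qed.

Lemma derivable_snd (V W : normedModType R) (g : R -> V * W) t :
  derivable g t 1 -> derivable (fun s => (g s).2) t 1 /\ 'D_1 (fun s => (g s).2) t = ('D_1 g t).2.
Proof.
move=> /cvg_ex[l hl].
have h1 : (fun h : R => h^-1 *: ((g (h *: 1 + t)).2 - (g t).2)) x @[x --> 0^'] --> l.2.
  apply: (@cvg_comp _ _ _ (fun h : R => h^-1 *: (g (h *: 1 + t) - g t)) snd _ _ _ hl).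
  by case: (l) => a b; exact: cvg_snd.
split; first by apply/cvg_ex; exists l.2.
rewrite /derive (cvg_lim _ h1) //.
by rewrite (cvg_lim _ hl).
Qed.

Lemma derivable_coords g t : derivable g t 1 -> deriv_coords g t ('D_1 g t).
Proof.
move=> hg j; have [h1 <-] := derivable_fst hg; have [h2 <-] := derivable_snd hg.
split.
  by rewrite (derive_mx h1) mxE; apply: derivableP; exact: ((derivable_mxP _ _ _).1 h1).
by rewrite (derive_mx h2) mxE; apply: derivableP; exact: ((derivable_mxP _ _ _).1 h2).
Qed.

Lemma is_derive_coords g t v : deriv_coords g t v -> is_derive t 1 g v.
Proof.
move=> h.
have h1 : derivable (fun s => (g s).1) t 1.
  by apply/derivable_mxP => i j; rewrite ord1; have [d _] := h j; exact: ex_derive.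
have h2 : derivable (fun s => (g s).2) t 1.
  by apply/derivable_mxP => i j; rewrite ord1; have [_ d] := h j; exact: ex_derive.
have hg : derivable g t 1.
  rewrite (_ : g = (fun s => ((g s).1, (g s).2))); last by apply/funext => s; case: (g s).
  apply: (derivable1_diffP _ _).2; apply: differentiable_pair.
    exact: (derivable1_diffP _ _).1 h1.
  exact: (derivable1_diffP _ _).1 h2.
apply: DeriveDef => //.
have [_ e1] := derivable_fst hg; have [_ e2] := derivable_snd hg.
rewrite [LHS]surjective_pairing -e1 -e2 [RHS]surjective_pairing; congr (_, _).
  by rewrite (derive_mx h1); apply/rowP => j; rewrite mxE; have [d _] := h j; exact: derive_val.
by rewrite (derive_mx h2); apply/rowP => j; rewrite mxE; have [_ d] := h j; exact: derive_val.
Qed.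

End Curves.

(** * The twist *)

(* [omega0_dtwist] in coordinates: P, Q and y are the squared norms and the scalar
   product of the real and imaginary parts of the point, p1, ..., q2' the scalar
   products of these with two tangent vectors, and v11, ..., v22 those of the
   tangent vectors with each other. *)
Lemma twist_symplectic_identity (R : fieldType) (b P Q y : R)
    (p1 p2 q1 q2 p1' p2' q1' q2' v11 v12 v21 v22 : R) (hD : 1 + b ^+ 2 * (P * Q - y ^+ 2) != 0) 
    (h2 : (2 : R) != 0) :
  let k := - 2^-1 * (1 + b ^+ 2 * (P * Q - y ^+ 2))^-1 * b ^+ 2 in
  let dy := p2 + q1 in let dP := 2 * p1 in let dQ := 2 * q2 in
  let dy' := p2' + q1' in let dP' := 2 * p1' in let dQ' := 2 * q2' in
  let K := k * (dP * Q + P * dQ - 2 * y * dy) in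
  let K' := k * (dP' * Q + P * dQ' - 2 * y * dy') in
  let c1 := 1 + b * y in let d1 := - (b * P) in let c2 := b * Q in let d2 := 1 - b * y in
  let a1 := K * c1 + b * dy in let b1 := K * d1 - b * dP in
  let a2 := K * c2 + b * dQ in let b2 := K * d2 - b * dy in
  let a1' := K' * c1 + b * dy' in let b1' := K' * d1 - b * dP' in
  let a2' := K' * c2 + b * dQ' in let b2' := K' * d2 - b * dy' in
  (1 + b ^+ 2 * (P * Q - y ^+ 2))^-1 * (
    (a1 * a2' - a2 * a1') * P + (b1 * b2' - b2 * b1') * Q
    + (a1 * b2' + b1 * a2' - (a2 * b1' + b2 * a1')) * y
    + (a1 * c2 - a2 * c1) * p1' + (a1 * d2 - a2 * d1) * p2'
    + (b1 * c2 - b2 * c1) * q1' + (b1 * d2 - b2 * d1) * q2'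
    + (c1 * a2' - c2 * a1') * p1 + (d1 * a2' - d2 * a1') * p2
    + (c1 * b2' - c2 * b1') * q1 + (d1 * b2' - d2 * b1') * q2
    + (c1 * d2 - c2 * d1) * v12 + (d1 * c2 - d2 * c1) * v21) = v12 - v21.
Proof.
move=> k dy dP dQ dy' dP' dQ' K K' c1 d1 c2 d2 a1 b1 a2 b2 a1' b1' a2' b2'.
rewrite /a1 /b1 /a2 /b2 /a1' /b1' /a2' /b2' /K /K' /c1 /d1 /c2 /d2 /dy /dP /dQ /dy' /dP' /dQ' /k.
by field; rewrite ?hD ?h2.
Qed.

Section Twist.
Context {R : realType} {n : nat}.
Implicit Types (e : pred 'I_n) (x y z : 'rV[R]_n) (u v : realC R n).

(** The predicate [e] will select all coordinates for the projective space and all but one for the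
    quadric. *)
Definition mdot e x y : R := \sum_(j | e j) x 0 j * y 0 j.

Lemma mdotC e x y : mdot e x y = mdot e y x.
Proof. by apply: eq_bigr => j _; rewrite mulrC. Qed.

Lemma mdotDl e x y z : mdot e (x + y) z = mdot e x z + mdot e y z.
Proof. by rewrite -big_split; apply: eq_bigr => j _; rewrite mxE mulrDl. Qed.

Lemma mdotZl e a x y : mdot e (a *: x) y = a * mdot e x y.
Proof. by rewrite /mdot mulr_sumr; apply: eq_bigr => j _; rewrite mxE mulrA. Qed.

Lemma mdotDr e x y z : mdot e z (x + y) = mdot e z x + mdot e z y.
Proof. by rewrite mdotC mdotDl !(mdotC _ z). Qed.

Lemma mdotZr e a x y : mdot e x (a *: y) = a * mdot e x y.
Proof. by rewrite mdotC mdotZl (mdotC _ x). Qed.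

Lemma eq_mdot e x x' y y' : (forall j, e j -> x 0 j = x' 0 j) ->
  (forall j, e j -> y 0 j = y' 0 j) -> mdot e x y = mdot e x' y'.
Proof. by move=> hx hy; apply: eq_bigr => j ej; rewrite hx ?hy. Qed.

Lemma mdot_ge0 e x : 0 <= mdot e x x.
Proof. by apply: sumr_ge0 => j _; rewrite -expr2 sqr_ge0. Qed.

Lemma dot_split e x y : dot x y = mdot e x y + mdot (predC e) x y.
Proof. by rewrite /dot (bigID e). Qed.

Lemma cauchy_schwarz e x y : 0 <= mdot e x x * mdot e y y - mdot e x y ^+ 2.
Proof.
have [x0|x0] := eqVneq (mdot e x x) 0.
  suff -> : mdot e x y = 0 by rewrite x0 mul0r expr0n /= subrr.
  apply: big1 => j ej; move/eqP : x0; rewrite psumr_eq0; last by move=> i _; rewrite -expr2 sqr_ge0.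
  by move=> /allP /(_ j (mem_index_enum j)) /implyP /(_ ej); rewrite mulf_eq0 orbb => /eqP->; rewrite mul0r.
have xp : 0 < mdot e x x by rewrite lt_def x0 mdot_ge0.
rewrite -(pmulr_rge0 _ xp).
have := mdot_ge0 e (mdot e x x *: y + - mdot e x y *: x).
rewrite !(mdotDl, mdotDr, mdotZl, mdotZr) (mdotC _ y x) => h.
by apply: le_trans h _; rewrite le_eqVlt; apply/orP; left; apply/eqP; ring.
Qed.

Definition gram e u : R := mdot e u.1 u.1 * mdot e u.2 u.2 - mdot e u.1 u.2 ^+ 2.

Lemma gram_ge0 e u : 0 <= gram e u.
Proof. exact: cauchy_schwarz. Qed.

(** This is cos B in the description of [twist], where tan B = b l; the inverse square root keeps it
    [elementary]. *)
Definition twist_scale e (b : R) u : R := (Num.sqrt (1 + b ^+ 2 * gram e u))^-1.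

Lemma twist_arg_gt0 e b u : 0 < 1 + b ^+ 2 * gram e u.
Proof. by rewrite ltr_wpDr ?ltr01 // mulr_ge0 ?sqr_ge0 ?gram_ge0. Qed.

Lemma twist_scale_sqr e b u : twist_scale e b u ^+ 2 = (1 + b ^+ 2 * gram e u)^-1.
Proof. by rewrite exprVn sqr_sqrtr // ltW // twist_arg_gt0. Qed.

Lemma twist_scale_sqrM e b u : twist_scale e b u ^+ 2 * (1 + b ^+ 2 * gram e u) = 1.
Proof. by rewrite twist_scale_sqr mulVf // gt_eqF // twist_arg_gt0. Qed.

(* On the coordinates in [e], this is [u |-> cos B u + sin B / l L u] with
   [L = u.2 u.1^T - u.1 u.2^T] the angular momentum matrix, [l = sqrt (gram e u)]
   its norm and [tan B = b l]: the rotation by the angle [B] of the plane spanned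
   by [u.1] and [u.2]. Functions of [gram e] generate such maps. *)
Definition twist e b u : realC R n :=
  let w := twist_scale e b u in
  let y := mdot e u.1 u.2 in
  (\row_j (if e j then w * ((1 + b * y) * u.1 0 j - b * mdot e u.1 u.1 * u.2 0 j) else u.1 0 j),
   \row_j (if e j then w * (b * mdot e u.2 u.2 * u.1 0 j + (1 - b * y) * u.2 0 j) else u.2 0 j)).

(** The twist turns the plane of the real and imaginary parts rigidly. In the computation each
    product acquires the factor [w ^+ 2 * (1 + b ^+ 2 * gram e u)], which is 1. *)
Lemma mdot_twist e b u :
  [/\ mdot e (twist e b u).1 (twist e b u).1 = mdot e u.1 u.1,
      mdot e (twist e b u).2 (twist e b u).2 = mdot e u.2 u.2 &
      mdot e (twist e b u).1 (twist e b u).2 = mdot e u.1 u.2].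
Proof.
have w2 := twist_scale_sqrM e b u; rewrite /gram in w2.
set w := twist_scale e b u in w2 *.
pose X1 := (w * (1 + b * mdot e u.1 u.2)) *: u.1 + (- (w * b * mdot e u.1 u.1)) *: u.2.
pose X2 := (w * b * mdot e u.2 u.2) *: u.1 + (w * (1 - b * mdot e u.1 u.2)) *: u.2.
have h1 j : e j -> (twist e b u).1 0 j = X1 0 j by move=> ej; rewrite !mxE ej -/w; ring.
have h2 j : e j -> (twist e b u).2 0 j = X2 0 j by move=> ej; rewrite !mxE ej -/w; ring.
rewrite (eq_mdot h1 h1) (eq_mdot h2 h2) (eq_mdot h1 h2) /X1 /X2.
rewrite !(mdotDl, mdotDr, mdotZl, mdotZr) (mdotC _ u.2 u.1).
set P := mdot e u.1 u.1 in w2 *; set Q := mdot e u.2 u.2 in w2 *; set y := mdot e u.1 u.2 in w2 *.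
by split; rewrite -[RHS]mulr1 -[in RHS]w2; ring.
Qed.

Lemma gram_twist e b u : gram e (twist e b u) = gram e u.
Proof. by rewrite /gram; have [-> -> ->] := mdot_twist e b u. Qed.

(** The Gram determinant is preserved, so [b] and [- b] give opposite angles in the same plane. *)
Lemma twistK e b u : twist e (- b) (twist e b u) = u.
Proof.
have [h1 h2 h3] := mdot_twist e b u.
have w2 := twist_scale_sqrM e b u.
have hw : twist_scale e (- b) (twist e b u) = twist_scale e b u.
  by rewrite /twist_scale sqrrN gram_twist.
rewrite [LHS]/twist h1 h2 h3 hw [RHS]surjective_pairing.
rewrite /gram in w2; set w := twist_scale e b u in w2 *.
by congr (_, _); apply/rowP => j; rewrite !mxE; case ej : (e j); rewrite ?ej //= -/w;
  rewrite -[RHS]mul1r -[in RHS]w2; ring.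
Qed.

(** The differential is written out so that symplecticity becomes an algebraic identity;
    [deriv_coords_twist] shows that it is the derivative along curves. *)
Definition dtwist e b u v : realC R n :=
  let w := twist_scale e b u in
  let P := mdot e u.1 u.1 in let Q := mdot e u.2 u.2 in let y := mdot e u.1 u.2 in
  let dP := 2 * mdot e u.1 v.1 in let dQ := 2 * mdot e u.2 v.2 in
  let dy := mdot e u.1 v.2 + mdot e u.2 v.1 in
  let dw := - 2^-1 * w ^+ 3 * (b ^+ 2 * (dP * Q + P * dQ - 2 * y * dy)) in
  (\row_j (if e j then dw * ((1 + b * y) * u.1 0 j - b * P * u.2 0 j)
     + w * (b * dy * u.1 0 j + (1 + b * y) * v.1 0 j - (b * dP * u.2 0 j + b * P * v.2 0 j))
     else v.1 0 j),
   \row_j (if e j then dw * (b * Q * u.1 0 j + (1 - b * y) * u.2 0 j)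
     + w * (b * dQ * u.1 0 j + b * Q * v.1 0 j + (- (b * dy) * u.2 0 j + (1 - b * y) * v.2 0 j))
     else v.2 0 j)).

Lemma omega0_split e u v : omega0 u v =
  mdot e u.1 v.2 - mdot e u.2 v.1 + (mdot (predC e) u.1 v.2 - mdot (predC e) u.2 v.1).
Proof. by rewrite /omega0 !(dot_split e); ring. Qed.

(** Off [e] the differential is the identity. On [e], once [w] is pulled out of both vectors it
    occurs only as [w ^+ 2], so the expression is rational, and expanding the scalar products gives
    [twist_symplectic_identity]. *)
Lemma omega0_dtwist e b u v v' : omega0 (dtwist e b u v) (dtwist e b u v') = omega0 v v'.
Proof.
rewrite !(omega0_split e); congr (_ + _); last first.
  by congr (_ - _); apply: eq_mdot => j /negbTE /= ej; rewrite mxE ej.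
set w := twist_scale e b u.
have w2 : w ^+ 2 = (1 + b ^+ 2 * gram e u)^-1 by exact: twist_scale_sqr.
set P := mdot e u.1 u.1; set Q := mdot e u.2 u.2; set y := mdot e u.1 u.2.
pose k := - 2^-1 * (1 + b ^+ 2 * (P * Q - y ^+ 2))^-1 * b ^+ 2.
(* [K v] is the logarithmic derivative dw / w of the scale in the direction [v]. *)
pose K (v : realC R n) := k * (2 * mdot e u.1 v.1 * Q + P * (2 * mdot e u.2 v.2)
  - 2 * y * (mdot e u.1 v.2 + mdot e u.2 v.1)).
pose dy (v : realC R n) := mdot e u.1 v.2 + mdot e u.2 v.1.
pose X1 (v : realC R n) := w *: ((K v * (1 + b * y) + b * dy v) *: u.1
  + (K v * - (b * P) - b * (2 * mdot e u.1 v.1)) *: u.2 + (1 + b * y) *: v.1 + - (b * P) *: v.2).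
pose X2 (v : realC R n) := w *: ((K v * (b * Q) + b * (2 * mdot e u.2 v.2)) *: u.1
  + (K v * (1 - b * y) - b * dy v) *: u.2 + (b * Q) *: v.1 + (1 - b * y) *: v.2).
have w3 : w ^+ 3 = w * (1 + b ^+ 2 * (P * Q - y ^+ 2))^-1 by rewrite exprS w2.
have h1 v0 j : e j -> (dtwist e b u v0).1 0 j = (X1 v0) 0 j.
  by move=> ej; rewrite !mxE ej -/w w3 -/P -/Q -/y /K /dy /k; ring.
have h2 v0 j : e j -> (dtwist e b u v0).2 0 j = (X2 v0) 0 j.
  by move=> ej; rewrite !mxE ej -/w w3 -/P -/Q -/y /K /dy /k; ring.
rewrite (eq_mdot (h1 v) (h2 v')) (eq_mdot (h2 v) (h1 v')) /X1 /X2 !(mdotZl e w, mdotZr e w).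
rewrite !mulrA -expr2 w2 -mulrBr.
have D0 : 1 + b ^+ 2 * (P * Q - y ^+ 2) != 0 by rewrite gt_eqF // (twist_arg_gt0 e b u).
rewrite -(@twist_symplectic_identity _ b P Q y (mdot e u.1 v.1) (mdot e u.1 v.2) (mdot e u.2 v.1)
  (mdot e u.2 v.2) (mdot e u.1 v'.1) (mdot e u.1 v'.2) (mdot e u.2 v'.1)
  (mdot e u.2 v'.2) (mdot e v.1 v'.1) (mdot e v.1 v'.2) (mdot e v.2 v'.1) (mdot e v.2 v'.2) D0) //.
congr (_ * _).
rewrite !(mdotDl, mdotDr, mdotZl, mdotZr) (mdotC _ u.2 u.1) !(mdotC _ _ u.1) !(mdotC _ _ u.2) (mdotC _ u.2 u.1).
rewrite -/P -/Q -/y -/k -/(dy v) -/(dy v') -/(K v) -/(K v').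
ring.
Qed.

End Twist.

(** * Derivative along curves and smoothness of the twist *)

Section Maps.
Context {R : realType}.

Section Pointwise.
Variables (V : normedModType R) (x v : V) (f g : V -> R) (df dg : R).
Hypotheses (hf : is_derive x v f df) (hg : is_derive x v g dg).

Lemma is_deriveD_fun : is_derive x v (fun y => f y + g y) (df + dg).
Proof. exact: is_deriveD. Qed.

Lemma is_deriveB_fun : is_derive x v (fun y => f y - g y) (df - dg).
Proof. exact: is_deriveB. Qed.

Lemma is_deriveM_fun : is_derive x v (fun y => f y * g y) (df * g x + f x * dg).
Proof. by apply: is_derive_eq (is_deriveM hf hg) _; rewrite addrC [df * _]mulrC. Qed.

Lemma is_deriveMl_fun c : is_derive x v (fun y => c * f y) (c * df).
Proof. exact: is_deriveZ. Qed.

End Pointwise.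

Variable n : nat.
Implicit Types (e : pred 'I_n) (g h : R -> realC R n) (u v w : realC R n) (t : R).

Lemma is_derive_mdot e (x y : R -> 'rV[R]_n) t (dx dy : 'rV[R]_n) :
  (forall j, is_derive t 1 (fun s => x s 0 j) (dx 0 j)) ->
  (forall j, is_derive t 1 (fun s => y s 0 j) (dy 0 j)) ->
  is_derive t 1 (fun s => mdot e (x s) (y s)) (mdot e dx (y t) + mdot e (x t) dy).
Proof.
move=> hx hy; rewrite -big_split /=.
by apply: is_derive_bigsum => j; apply: is_deriveM_fun.
Qed.

Lemma is_derive_omega0 g h t v w : deriv_coords g t v -> deriv_coords h t w ->
  is_derive t 1 (fun s => omega0 (g s) (h s)) (omega0 v (h t) + omega0 (g t) w).
Proof.
move=> hg hh.
have d := @is_derive_mdot predT.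
apply: is_derive_eq (is_deriveB_fun
  (d _ _ _ _ _ (fun j => (hg j).1) (fun j => (hh j).2))
  (d _ _ _ _ _ (fun j => (hg j).2) (fun j => (hh j).1))) _.
by rewrite /omega0 /mdot /dot; ring.
Qed.

Lemma deriv_coords_twist e b g t v : deriv_coords g t v ->
  deriv_coords (twist e b \o g) t (dtwist e b (g t) v).
Proof.
move=> hg.
have h1 := fun j => (hg j).1; have h2 := fun j => (hg j).2.
have dP := is_derive_mdot e h1 h1; have dQ := is_derive_mdot e h2 h2.
have dy := is_derive_mdot e h1 h2.
have dw : is_derive t 1 (fun s => twist_scale e b (g s)) (- 2^-1 * twist_scale e b (g t) ^+ 3 *
    (b ^+ 2 * (2 * mdot e (g t).1 v.1 * mdot e (g t).2 (g t).2
       + mdot e (g t).1 (g t).1 * (2 * mdot e (g t).2 v.2)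
       - 2 * mdot e (g t).1 (g t).2 * (mdot e (g t).1 v.2 + mdot e (g t).2 v.1)))).
  have dD := is_deriveB_fun (is_deriveM_fun dP dQ) (is_deriveM_fun dy dy).
  have dA := is_deriveD_fun (is_derive_cst (1 : R) t 1) (is_deriveMl_fun dD (b ^+ 2)).
  have := @is_derive_rsqrt _ _ (fun s => 1 + b ^+ 2 * gram e (g s)) _ _ _ (twist_arg_gt0 e b (g t)) dA.
  move=> H; apply: is_derive_eq H _; rewrite /twist_scale /gram.
  rewrite (mdotC _ v.1 (g t).1) (mdotC _ v.2 (g t).2) (mdotC _ v.1 (g t).2); ring.
have dPt := is_deriveMl_fun dP b; have dQt := is_deriveMl_fun dQ b; have dyt := is_deriveMl_fun dy b.
have dp1 := is_deriveD_fun (is_derive_cst (1 : R) t 1) dyt.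
have dm1 := is_deriveB_fun (is_derive_cst (1 : R) t 1) dyt.
move=> j; split.
  rewrite (_ : (fun s => _) = (fun s => if e j then twist_scale e b (g s) *
    ((1 + b * mdot e (g s).1 (g s).2) * (g s).1 0 j - b * mdot e (g s).1 (g s).1 * (g s).2 0 j)
    else (g s).1 0 j)); last by apply/funext => s; rewrite mxE.
  rewrite mxE; case: (e j) => //.
  apply: is_derive_eq (is_deriveM_fun dw (is_deriveB_fun (is_deriveM_fun dp1 (h1 j))
    (is_deriveM_fun dPt (h2 j)))) _.
  rewrite (mdotC _ v.1 (g t).1) (mdotC _ v.1 (g t).2); rewrite /cst; ring.
rewrite (_ : (fun s => _) = (fun s => if e j then twist_scale e b (g s) *
    (b * mdot e (g s).2 (g s).2 * (g s).1 0 j + (1 - b * mdot e (g s).1 (g s).2) * (g s).2 0 j)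
    else (g s).2 0 j)); last by apply/funext => s; rewrite mxE.
rewrite mxE; case: (e j) => //.
apply: is_derive_eq (is_deriveM_fun dw (is_deriveD_fun (is_deriveM_fun dQt (h1 j))
    (is_deriveM_fun dm1 (h2 j)))) _.
rewrite (mdotC _ v.2 (g t).2) (mdotC _ v.1 (g t).2) /cst; ring.
Qed.

Definition elementary_map (V : normedModType R) (F : V -> realC R n) :=
  forall j, elementary (fun x => (F x).1 0 j) /\ elementary (fun x => (F x).2 0 j).

Lemma elementary_bigsum (V : normedModType R) I (r : seq I) (P : pred I) (f : I -> V -> R) :
  (forall i, elementary (f i)) -> elementary (fun x => \sum_(i <- r | P i) f i x).
Proof.
move=> hf; elim: r => [|i r IH].
  rewrite (_ : (fun x => _) = (fun=> 0)); first exact: elementary_cst.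
  by apply/funext => x; rewrite big_nil.
rewrite (_ : (fun x => _) = (fun x => (if P i then f i x else 0) + \sum_(i <- r | P i) f i x)).
  by apply: elementaryD IH; case: (P i) => //; exact: elementary_cst.
by apply/funext => x; rewrite big_cons; case: (P i); rewrite ?add0r.
Qed.

Lemma elementary_mdot (V : normedModType R) e (X Y : V -> 'rV[R]_n) :
  (forall j, elementary (fun x => X x 0 j)) -> (forall j, elementary (fun x => Y x 0 j)) ->
  elementary (fun x => mdot e (X x) (Y x)).
Proof. by move=> hX hY; apply: elementary_bigsum => j; apply: elementaryM. Qed.

Lemma elementary_omega0 (V : normedModType R) (F G : V -> realC R n) :
  elementary_map F -> elementary_map G -> elementary (fun x => omega0 (F x) (G x)).
Proof.
move=> hF hG; apply: elementaryB; apply: (@elementary_mdot V predT) => j.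
- exact: (hF j).1.
- exact: (hG j).2.
- exact: (hF j).2.
- exact: (hG j).1.
Qed.

Lemma elementary_map_twist (V : normedModType R) e b (F : V -> realC R n) :
  elementary_map F -> elementary_map (fun x => twist e b (F x)).
Proof.
move=> hF.
have h1 := fun j => (hF j).1; have h2 := fun j => (hF j).2.
have eP := elementary_mdot e h1 h1; have eQ := elementary_mdot e h2 h2.
have ey := elementary_mdot e h1 h2.
have ec c : @elementary R V (fun=> c) := elementary_cst V c.
have ew : elementary (fun x => twist_scale e b (F x)).
  apply: elementary_rsqrt; first by move=> x; exact: twist_arg_gt0.
  by apply: elementaryD (ec _) _; apply: elementaryM (ec _) _; apply: elementaryB;
    rewrite ?expr2; apply: elementaryM.
move=> j; split.
  rewrite (_ : (fun s => _) = (fun s => if e j then twist_scale e b (F s) *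
    ((1 + b * mdot e (F s).1 (F s).2) * (F s).1 0 j - b * mdot e (F s).1 (F s).1 * (F s).2 0 j)
    else (F s).1 0 j)); last by apply/funext => s; rewrite mxE.
  case: (e j) => //; apply: elementaryM ew _; apply: elementaryB; apply: elementaryM => //.
    by apply: elementaryD (ec _) _; exact: elementaryM.
  exact: elementaryM.
rewrite (_ : (fun s => _) = (fun s => if e j then twist_scale e b (F s) *
    (b * mdot e (F s).2 (F s).2 * (F s).1 0 j + (1 - b * mdot e (F s).1 (F s).2) * (F s).2 0 j)
    else (F s).2 0 j)); last by apply/funext => s; rewrite mxE.
case: (e j) => //; apply: elementaryM ew _; apply: elementaryD; apply: elementaryM => //.
  exact: elementaryM.
by apply: elementaryB (ec _) _; exact: elementaryM.
Qed.

End Maps.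

(** * Conjugated rotations and their Hamiltonians *)

Section Phase.
Context {R : realType}.

(** Multiplication by [a +i* c] in real coordinates; for [a ^+ 2 + c ^+ 2 = 1] it is the circle
    action on the fibres over the projective space. *)
Definition phase {n} (a c : R) (u : realC R n) : realC R n :=
  (a *: u.1 - c *: u.2, c *: u.1 + a *: u.2).

Lemma cvec_phase n a c (u : realC R n) : cvec (phase a c u) = (a +i* c) *: cvec u.
Proof. by apply/rowP => j; rewrite !mxE /=; congr (_ +i* _); ring. Qed.

Lemma cvec_inj n : injective (@cvec R n).
Proof.
move=> [x y] [x' y'] /rowP h.
by congr (_, _); apply/rowP => j; have := h j; rewrite !mxE => -[].
Qed.

Lemma hptZ n (a : R[i]) (z : 'rV[R[i]]_n) : a != 0 -> hpt (a *: z) = hpt z.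
Proof.
move=> a0; apply/seteqP; split=> _ [b _ <-].
  by exists (b * a) => //; rewrite scalerA.
by exists (b / a) => //; rewrite scalerA divfK.
Qed.

Lemma unit_complex_neq0 (a c : R) : a ^+ 2 + c ^+ 2 = 1 -> (a +i* c) != 0.
Proof.
move=> ac; apply/eqP => -[a0 c0]; move: ac; rewrite a0 c0 expr0n /= addr0 => /eqP.
by rewrite eq_sym oner_eq0.
Qed.

Lemma hpt_phase n a c (u : realC R n) : a ^+ 2 + c ^+ 2 = 1 ->
  hpt (cvec (phase a c u)) = hpt (cvec u).
Proof. by move=> ac; rewrite cvec_phase hptZ // unit_complex_neq0. Qed.

Definition cnorm2 {n} (u : realC R n) : R := dot u.1 u.1 + dot u.2 u.2.

Lemma dot_mdot n (x y : 'rV[R]_n) : dot x y = mdot predT x y.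
Proof. by []. Qed.

Lemma cnorm2_phase n a c (u : realC R n) : cnorm2 (phase a c u) = (a ^+ 2 + c ^+ 2) * cnorm2 u.
Proof.
rewrite /cnorm2 /phase /= !dot_mdot -!scaleNr !(mdotDl, mdotDr, mdotZl, mdotZr) (mdotC _ u.2 u.1).
by ring.
Qed.

Lemma omega0_phase n a c (u v : realC R n) : a ^+ 2 + c ^+ 2 = 1 ->
  omega0 (phase a c u) (phase a c v) = omega0 u v.
Proof.
move=> ac; rewrite /omega0 /phase /= !dot_mdot -!scaleNr !(mdotDl, mdotDr, mdotZl, mdotZr).
by rewrite -[RHS]mul1r -ac; ring.
Qed.

Lemma hpt_eq_phase n (u v : realC R n) : cnorm2 u = 2 -> cnorm2 v = 2 ->
  hpt (cvec u) = hpt (cvec v) -> exists a c, a ^+ 2 + c ^+ 2 = 1 /\ u = phase a c v.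
Proof.
move=> nu nv huv.
have : hpt (cvec v) (cvec u) by rewrite -huv; exists 1; rewrite ?scale1r.
move=> [[a c] _]; rewrite -cvec_phase => /cvec_inj e.
exists a, c; split=> //.
have := cnorm2_phase a c v; rewrite e nu nv => h.
by apply: (@mulIf _ (2 : R)); rewrite ?mul1r // pnatr_eq0.
Qed.

Lemma CP_rep N (P : set 'rV[R[i]]_N.+1) : CP R N P ->
  exists u : realC R N.+1, cnorm2 u = 2 /\ hpt (cvec u) = P.
Proof.
move=> [z z0 <-].
pose v : realC R N.+1 := (\row_j complex.Re (z 0 j), \row_j complex.Im (z 0 j)).
have vz : cvec v = z.
  by apply/rowP => j; rewrite !mxE; case: (z 0 j).
have nv : 0 < cnorm2 v.
  rewrite lt_def addr_ge0 ?andbT ?(mdot_ge0 predT) //.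
  apply: contra z0; rewrite paddr_eq0 ?(mdot_ge0 predT) // !psumr_eq0; try by move=> j _; rewrite -expr2 sqr_ge0.
  move=> /andP[/allP h1 /allP h2]; apply/eqP/rowP => j; rewrite -vz !mxE.
  have := h1 j (mem_index_enum j); have := h2 j (mem_index_enum j).
  by rewrite !mxE !mulf_eq0 !orbb => /eqP -> /eqP ->.
have s0 : 0 < Num.sqrt (2 / cnorm2 v) by rewrite sqrtr_gt0 divr_gt0.
exists (phase (Num.sqrt (2 / cnorm2 v)) 0 v); split.
  rewrite cnorm2_phase expr0n addr0 sqr_sqrtr ?divfK ?gt_eqF //.
  by rewrite divr_ge0 // ltW.
rewrite cvec_phase hptZ ?vz //.
by apply/eqP => -[/eqP]; rewrite gt_eqF.
Qed.

End Phase.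

Section Flow.
Context {R : realType} {N : nat}.
Variable M : set (set 'rV[R[i]]_N.+1).
Implicit Types (u v : realC R N.+1) (F G A : realC R N.+1 -> realC R N.+1).

(* Lifts to the circle bundle over [M] of the symplectic self-maps of [M]. *)
Record symplectic_lift F : Prop := SymplecticLift {
  lift_phase : forall a c u, a ^+ 2 + c ^+ 2 = 1 -> F (phase a c u) = phase a c (F u);
  lift_sphere : forall u, sphere_over M u -> sphere_over M (F u);
  lift_elementary : forall (V : normedModType R) (X : V -> realC R N.+1),
    elementary_map X -> elementary_map (F \o X);
  lift_omega0 : exists dF : realC R N.+1 -> realC R N.+1 -> realC R N.+1,
    (forall g t v, deriv_coords g t v -> deriv_coords (F \o g) t (dF (g t) v)) /\
    (forall u v v', omega0 (dF u v) (dF u v') = omega0 v v') }.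

Lemma symplectic_lift_comp F G : symplectic_lift F -> symplectic_lift G ->
  symplectic_lift (F \o G).
Proof.
move=> hF hG; split.
- by move=> a c u ac /=; rewrite (lift_phase hG) // (lift_phase hF).
- by move=> u hu; apply: (lift_sphere hF); exact: (lift_sphere hG).
- by move=> V X hX; exact: (lift_elementary hF (lift_elementary hG hX)).
have [dF [dF1 dF2]] := lift_omega0 hF; have [dG [dG1 dG2]] := lift_omega0 hG.
exists (fun u v => dF (G u) (dG u v)); split.
  by move=> g t v hg; exact: (dF1 (G \o g) t _ (dG1 g t v hg)).
by move=> u v v'; rewrite dF2 dG2.
Qed.

(* exp (t A) when A^3 = -A. *)
Definition generated_rotation A (t : R) u : realC R N.+1 :=
  u + sin t *: A u + (1 - cos t) *: A (A u).

(** [generator_hamiltonian] says that [A] is infinitesimally symplectic,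
    [omega0 (A u) v + omega0 u (A v) = 0], so that half of [omega0 (A u) u] generates exp (t A);
    [generator_phase] lets this function descend to [M]. *)
Record rotation_generator A : Prop := RotationGenerator {
  generator_linear : forall (a : R) u v, A (a *: u + v) = a *: A u + A v;
  generator_cube : forall u, A (A (A u)) = - A u;
  generator_phase : forall a c u, A (phase a c u) = phase a c (A u);
  generator_hamiltonian : forall u v, omega0 (A u) v = omega0 (A v) u;
  generator_elementary : forall (V : normedModType R) (X : V -> realC R N.+1),
    elementary_map X -> elementary_map (A \o X);
  generator_derive : forall g t v, deriv_coords g t v -> deriv_coords (A \o g) t (A v);
  generator_sphere : forall t u, sphere_over M u -> sphere_over M (generated_rotation A t u) }.

Lemma omega0Zl a u v : omega0 (a *: u) v = a * omega0 u v.
Proof. by rewrite /omega0 !dot_mdot /= !mdotZl mulrBr. Qed.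

Lemma phaseD a c u v : phase a c (u + v) = phase a c u + phase a c v.
Proof. by congr (_, _); apply/rowP => j; rewrite !mxE /=; ring. Qed.

Lemma phaseZ a c b u : phase a c (b *: u) = b *: phase a c u.
Proof. by congr (_, _); apply/rowP => j; rewrite !mxE /=; ring. Qed.

Lemma smooth_on_elementary (V : normedModType R) (D : set V) (f g : V -> R) :
  elementary g -> (forall x, D x -> f x = g x) -> smooth_on D f.
Proof.
move=> eg fg a Da; have [U [h [oU Ua ch hh]]] := @elementary_smooth_on _ _ _ D eg a Da.
by exists U, h; split=> // x Dx Ux; rewrite fg // hh.
Qed.

Section ConjugatedRotation.
Variables F G A : realC R N.+1 -> realC R N.+1.
Hypotheses (MCP : M `<=` CP R N) (hF : symplectic_lift F) (hG : symplectic_lift G)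
  (FK : cancel F G) (GK : cancel G F) (hA : rotation_generator A).

(** An arbitrary choice of lifts, not assumed continuous; the default 0 is taken exactly off [M]. *)
Let section P : realC R N.+1 := xget 0 [set u | sphere_over M u /\ hpt (cvec u) = P].

Let sectionP P : M P -> sphere_over M (section P) /\ hpt (cvec (section P)) = P.
Proof.
move=> MP; have [u [nu uP]] := CP_rep (MCP MP).
apply: (@xgetPex _ 0 [set u | sphere_over M u /\ hpt (cvec u) = P]).
by exists u; split=> //; split=> //; rewrite uP.
Qed.

Let section_phase u : sphere_over M u ->
  exists a c, a ^+ 2 + c ^+ 2 = 1 /\ section (hpt (cvec u)) = phase a c u.
Proof.
move=> [nu Mu]; have [[ns _] hs] := sectionP Mu.
exact: hpt_eq_phase.
Qed.

(** The speed for which the time-one rotation is the quarter-turn. *)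
Let k : R := pi / 2.

Let H (t : R) P : R := k * 2^-1 * omega0 (A (F (section P))) (F (section P)).

(** Two lifts of a point differ by a unit phase, which commutes with [F] and [A] and preserves
    [omega0]; hence the choice made in [section] does not matter. *)
Let HE t u : sphere_over M u -> H t (hpt (cvec u)) = k * 2^-1 * omega0 (A (F u)) (F u).
Proof.
move=> hu; rewrite /H; have [a [c [ac ->]]] := section_phase hu.
by rewrite (lift_phase hF) // (generator_phase hA) omega0_phase.
Qed.

Let smoothH : smooth_hamiltonian M H.
Proof.
(* The formula of [HE] extends to the whole ambient space, where it is elementary. *)
pose h (x : (R * realC R N.+1)%type) := k * 2^-1 * omega0 (A (F x.2)) (F x.2).
apply: (@smooth_on_elementary _ _ _ h); last by move=> [t u] [_ /= hu]; exact: HE.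
have e2 : elementary_map (fun x : (R * realC R N.+1)%type => x.2).
  move=> j; split; apply: elementary_scalar; try by move=> c x y; rewrite !mxE.
    move=> x; apply: (@continuous_comp _ _ _ (fun x : (R * realC R N.+1)%type => x.2.1)
      (fun y : 'rV[R]_N.+1 => y 0 j)); last exact: coord_continuous.
    by apply: (@continuous_comp _ _ _ (@snd R (realC R N.+1)) (@fst _ _));
      [exact: cvg_snd|exact: cvg_fst].
  move=> x; apply: (@continuous_comp _ _ _ (fun x : (R * realC R N.+1)%type => x.2.2)
    (fun y : 'rV[R]_N.+1 => y 0 j)); last exact: coord_continuous.
  by apply: (@continuous_comp _ _ _ (@snd R (realC R N.+1)) (@snd _ _));
    [exact: cvg_snd|exact: cvg_snd].
have eF := lift_elementary hF e2.
apply: elementaryM; first exact: elementary_cst.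
by apply: elementary_omega0; [exact: (generator_elementary hA eF)|exact: eF].
Qed.

Let deriv_coords_rotation u t :
  deriv_coords (fun s => generated_rotation A (k * s) u) t
    (k *: A (generated_rotation A (k * t) u)).
Proof.
have AD u1 u2 : A (u1 + u2) = A u1 + A u2 by rewrite -[u1]scale1r (generator_linear hA) !scale1r.
have A0 : A 0 = 0 by apply: (addrI (A 0)); rewrite addr0 -AD addr0.
have AZ b u1 : A (b *: u1) = b *: A u1.
  by rewrite -[b *: u1]addr0 (generator_linear hA) A0 addr0.
rewrite /generated_rotation !AD !AZ (generator_cube hA).
set a := A u; set b := A a.
have hs : is_derive t 1 (fun s : R => sin (k * s)) (cos (k * t) * k).
  apply: is_derive_comp1 (is_derive_sin _).
  by apply: is_derive_eq (is_deriveMl_fun (is_derive_id t 1) k) _; rewrite mulr1.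
have hc : is_derive t 1 (fun s : R => cos (k * s)) (- sin (k * t) * k).
  apply: is_derive_comp1 (is_derive_cos _).
  by apply: is_derive_eq (is_deriveMl_fun (is_derive_id t 1) k) _; rewrite mulr1.
have hl (x y z : R) : is_derive t 1 (fun s : R => x + sin (k * s) * y + (1 - cos (k * s)) * z)
    (k * (y + sin (k * t) * z + (1 - cos (k * t)) * - y)).
  have H1 := is_deriveM_fun hs (is_derive_cst y t 1).
  have H2 := is_deriveM_fun (is_deriveB_fun (is_derive_cst (1 : R) t 1) hc) (is_derive_cst z t 1).
  apply: is_derive_eq (is_deriveD_fun (is_deriveD_fun (is_derive_cst x t 1) H1) H2) _.
  by rewrite /cst; ring.
move=> j; split.
  rewrite (_ : (fun s => _) = fun s => u.1 0 j + sin (k * s) * a.1 0 j + (1 - cos (k * s)) * b.1 0 j).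
    by rewrite !mxE; exact: hl.
  by apply/funext => s; rewrite !mxE.
rewrite (_ : (fun s => _) = fun s => u.2 0 j + sin (k * s) * a.2 0 j + (1 - cos (k * s)) * b.2 0 j).
  by rewrite !mxE; exact: hl.
by apply/funext => s; rewrite !mxE.
Qed.

(** Since [F] preserves [omega0], the pairing of the velocity with a tangent vector can be computed
    after applying [F], where the curve is an orbit of exp (k t A). *)
Let hamiltonian_flow u : sphere_over M u ->
  hamiltonian_curve M H (fun t => G (generated_rotation A (k * t) (F u))).
Proof.
move=> hu t _; set c := fun t => G _.
have cM s : sphere_over M (c s).
  by apply: (lift_sphere hG); apply: (generator_sphere hA); exact: (lift_sphere hF).
have [dG [hdG _]] := lift_omega0 hG; have [dF [hdF dF2]] := lift_omega0 hF.
have dc := hdG _ _ _ (deriv_coords_rotation (F u) t).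
have Dc := is_derive_coords dc.
(* Both sides are derivatives of one curve, the composite of [F] with [c], which is the rotation
   orbit because [F] inverts [G]. *)
have dFc : dF (c t) ('D_1 c t) = k *: A (F (c t)).
  have -> : 'D_1 c t = dG (generated_rotation A (k * t) (F u))
      (k *: A (generated_rotation A (k * t) (F u))) by exact: derive_val.
  have h1 := is_derive_coords (hdF _ _ _ dc).
  have h2 := is_derive_coords (deriv_coords_rotation (F u) t).
  have e : F \o (G \o (fun s => generated_rotation A (k * s) (F u))) =
      (fun s => generated_rotation A (k * s) (F u)) by apply/funext => s /=; rewrite GK.
  rewrite e in h1.
  rewrite -(@derive_val _ _ _ _ _ _ _ h1) (@derive_val _ _ _ _ _ _ _ h2).
  by rewrite /c GK.
split; [exact: cM|exact: (@ex_derive _ _ _ _ _ _ _ Dc)|].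
move=> g gM gt dg; have g0 : g 0 = c t := gt; clear gt.
have hg := derivable_coords dg.
have hFg := hdF _ _ _ hg.
have hAFg := generator_derive hA hFg.
rewrite (_ : (fun s => _) = fun s => k * 2^-1 * omega0 (A (F (g s))) (F (g s))); last first.
  by apply/funext => s; rewrite HE.
apply: is_derive_eq (is_deriveMl_fun (is_derive_omega0 hAFg hFg) _) _.
(* The symmetry of [omega0 (A _) _] makes the two terms of the product rule equal, which cancels the
   factor 1/2. *)
rewrite [omega0 (A (dF _ _)) _](generator_hamiltonian hA) /=.
rewrite -(dF2 (c t) ('D_1 c t) ('D_1 g 0)) dFc omega0Zl -g0 /=; by field.
Qed.

(* The Hamiltonian is [k / 2 * omega0 (A z) z] at [z = F u], since [F] is
   symplectic and conjugates the isotopy to the rotation group of [A]. *)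
Lemma conjugated_rotation_displaces (L : set (set 'rV[R[i]]_N.+1)) : L `<=` M ->
  (forall u, sphere_over M u -> L (hpt (cvec u)) ->
    ~ L (hpt (cvec (G (generated_rotation A (pi / 2) (F u)))))) ->
  displaceable M L.
Proof.
move=> LM hL; split=> //.
pose phi P := hpt (cvec (G (generated_rotation A (pi / 2) (F (section P))))).
exists phi.
  exists H; first exact: smoothH.
  move=> P MP; have [hs hP] := sectionP MP.
  exists (fun t => G (generated_rotation A (k * t) (F (section P)))); split.
  - exact: hamiltonian_flow.
  - rewrite mulr0 /generated_rotation sin0 cos0 subrr !scale0r !addr0 FK //.
  - by rewrite mulr1.
rewrite -subset0 => _ [[P LP <-] LQ].
have [hs hP] := sectionP (LM _ LP).
by apply: (hL (section P)) LQ => //; rewrite hP.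
Qed.

End ConjugatedRotation.
End Flow.

(** * Twists and rotation groups on the projective space and the quadric *)

Section Lifts.
Context {R : realType}.

Section Twist.
Context {n : nat}.
Implicit Types (e : pred 'I_n) (u v : realC R n).

(** A unit phase acts on the pair of real and imaginary parts by an orthogonal 2 x 2 matrix, so for
    normalized vectors [gram] depends only on the projective point. *)
Lemma mdot_phase e a c u : a ^+ 2 + c ^+ 2 = 1 ->
  [/\ mdot e (phase a c u).1 (phase a c u).1 =
        a ^+ 2 * mdot e u.1 u.1 - 2 * a * c * mdot e u.1 u.2 + c ^+ 2 * mdot e u.2 u.2,
      mdot e (phase a c u).2 (phase a c u).2 =
        c ^+ 2 * mdot e u.1 u.1 + 2 * a * c * mdot e u.1 u.2 + a ^+ 2 * mdot e u.2 u.2,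
      mdot e (phase a c u).1 (phase a c u).2 =
        a * c * (mdot e u.1 u.1 - mdot e u.2 u.2) + (a ^+ 2 - c ^+ 2) * mdot e u.1 u.2 &
      gram e (phase a c u) = gram e u].
Proof.
move=> ac.
have h1 : mdot e (phase a c u).1 (phase a c u).1 =
    a ^+ 2 * mdot e u.1 u.1 - 2 * a * c * mdot e u.1 u.2 + c ^+ 2 * mdot e u.2 u.2.
  by rewrite /phase /= -[- (c *: u.2)]scaleNr !(mdotDl, mdotDr, mdotZl, mdotZr) (mdotC _ u.2 u.1); ring.
have h2 : mdot e (phase a c u).2 (phase a c u).2 =
    c ^+ 2 * mdot e u.1 u.1 + 2 * a * c * mdot e u.1 u.2 + a ^+ 2 * mdot e u.2 u.2.
  by rewrite /phase /= !(mdotDl, mdotDr, mdotZl, mdotZr) (mdotC _ u.2 u.1); ring.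
have h3 : mdot e (phase a c u).1 (phase a c u).2 =
    a * c * (mdot e u.1 u.1 - mdot e u.2 u.2) + (a ^+ 2 - c ^+ 2) * mdot e u.1 u.2.
  by rewrite /phase /= -[- (c *: u.2)]scaleNr !(mdotDl, mdotDr, mdotZl, mdotZr) (mdotC _ u.2 u.1); ring.
split=> //; rewrite [LHS]/gram h1 h2 h3.
transitivity ((a ^+ 2 + c ^+ 2) ^+ 2 * gram e u); last by rewrite ac expr1n mul1r.
by rewrite /gram; ring.
Qed.

(** The angular momentum matrix of [u] is unchanged by unit phases. The twist therefore applies the
    same real matrix to [u] and to its multiple, and real matrices commute with phases. *)
Lemma twist_phase e b a c u : a ^+ 2 + c ^+ 2 = 1 ->
  twist e b (phase a c u) = phase a c (twist e b u).
Proof.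
move=> ac; have [h1 h2 h3 h4] := mdot_phase e u ac.
rewrite [LHS]/twist h1 h2 h3 /twist_scale h4 -/(twist_scale e b u).
set w := twist_scale e b u.
congr (_, _); apply/rowP => j; rewrite !mxE; case ej : (e j); rewrite ?mxE //= -/w.
  set P := mdot e u.1 u.1; set Q := mdot e u.2 u.2; set y := mdot e u.1 u.2.
  transitivity (w * (a * u.1 0 j - c * u.2 0 j + (a ^+ 2 + c ^+ 2) * b *
    (a * (y * u.1 0 j - P * u.2 0 j) - c * (Q * u.1 0 j - y * u.2 0 j)))).
    ring.
  by rewrite ac; ring.
set P := mdot e u.1 u.1; set Q := mdot e u.2 u.2; set y := mdot e u.1 u.2.
transitivity (w * (c * u.1 0 j + a * u.2 0 j + (a ^+ 2 + c ^+ 2) * b *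
    (c * (y * u.1 0 j - P * u.2 0 j) + a * (Q * u.1 0 j - y * u.2 0 j)))).
  ring.
by rewrite ac; ring.
Qed.

Lemma dot_twist e b u :
  [/\ dot (twist e b u).1 (twist e b u).1 = dot u.1 u.1,
      dot (twist e b u).2 (twist e b u).2 = dot u.2 u.2 &
      dot (twist e b u).1 (twist e b u).2 = dot u.1 u.2].
Proof.
have [h1 h2 h3] := mdot_twist e b u.
by rewrite !(dot_split e) h1 h2 h3; split; congr (_ + _);
  apply: eq_mdot => j /negbTE /= ej; rewrite mxE ej.
Qed.

Definition partial_phase e (a c : R) u : realC R n :=
  (\row_j (if e j then a * u.1 0 j - c * u.2 0 j else u.1 0 j),
   \row_j (if e j then c * u.1 0 j + a * u.2 0 j else u.2 0 j)).

End Twist.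

Section Sphere.
Context {N : nat}.
Implicit Types (u v : realC R N.+1).

Lemma sphere_over_CP u : sphere_over (CP R N) u <-> cnorm2 u = 2.
Proof.
split=> [[]//|nu]; split=> //; exists (cvec u) => //.
apply/eqP => u0; suff u00 : u = 0.
  move: nu; rewrite u00 /cnorm2 /dot !big1; try by move=> j _; rewrite mxE mul0r.
  by move=> /eqP; rewrite addr0 eq_sym pnatr_eq0.
by apply: cvec_inj; rewrite u0; apply/rowP => j; rewrite !mxE.
Qed.

Lemma sum_cvec_sqr u : \sum_j cvec u 0 j ^+ 2 =
  (dot u.1 u.1 - dot u.2 u.2) +i* (2 * dot u.1 u.2).
Proof.
rewrite /dot -sumrB mulr_sumr.
elim/big_rec3: _ => // j x y z _ ->.
by rewrite !mxE expr2 /=; congr (_ +i* _) => /=; ring.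
Qed.

(** The sum of the squares is |x|^2 - |y|^2 + 2 i x.y, while |x|^2 + |y|^2 = 2: the circle bundle
    over the quadric consists of the orthonormal pairs. *)
Lemma sphere_over_quadric u : sphere_over (quadric R N) u <->
  [/\ dot u.1 u.1 = 1, dot u.2 u.2 = 1 & dot u.1 u.2 = 0].
Proof.
split=> [[nu [z [z0 qz] hz]]|[h1 h2 h3]].
  have : hpt z (cvec u) by rewrite hz; exists 1; rewrite ?scale1r.
  move=> [a _ az]; have := sum_cvec_sqr u.
  (* Membership in the quadric only provides some vector [z] spanning the line; rescaling it
     multiplies the sum of squares by [a ^+ 2]. *)
  rewrite -az (eq_bigr (fun j => a ^+ 2 * z 0 j ^+ 2)); last by move=> j _; rewrite mxE exprMn.
  rewrite -mulr_sumr qz mulr0 => -[/esym e1 /esym e2]; split; lra.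
have nu : cnorm2 u = 2 by rewrite /cnorm2 h1 h2; ring.
split=> //; have [_ [z z0 hz]] := (sphere_over_CP u).2 nu.
exists (cvec u) => //; split; last by rewrite sum_cvec_sqr h1 h2 h3 subrr mulr0.
have : hpt z z by exists 1; rewrite ?scale1r.
rewrite hz => -[a _ ez]; apply/eqP => u0; move/eqP: z0; apply.
by rewrite -ez u0 scaler0.
Qed.

Lemma quadric_sub_CP : quadric R N `<=` CP R N.
Proof. by move=> _ [z [z0 _] <-]; exists z. Qed.

Lemma twist_lift (M : set (set 'rV[R[i]]_N.+1)) e b :
  (forall u, sphere_over M u -> sphere_over M (twist e b u)) ->
  symplectic_lift M (twist e b).
Proof.
move=> hM; split=> //.
- by move=> a c u; exact: twist_phase.
- by move=> V X; exact: elementary_map_twist.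
exists (dtwist e b); split; first by move=> g t v; exact: deriv_coords_twist.
by move=> u v v'; exact: omega0_dtwist.
Qed.

Lemma twist_lift_CP e b : symplectic_lift (CP R N) (twist e b).
Proof.
apply: twist_lift => u /sphere_over_CP nu; apply/sphere_over_CP.
by rewrite /cnorm2; have [-> -> _] := dot_twist e b u.
Qed.

Lemma twist_lift_quadric e b : symplectic_lift (quadric R N) (twist e b).
Proof.
apply: twist_lift => u /sphere_over_quadric [h1 h2 h3]; apply/sphere_over_quadric.
by have [-> -> ->] := dot_twist e b u.
Qed.

Section PartialPhase.
Variable e : pred 'I_N.+1.

Lemma cnorm2_partial_phase a c u : a ^+ 2 + c ^+ 2 = 1 -> cnorm2 (partial_phase e a c u) = cnorm2 u.
Proof.
move=> ac; rewrite /cnorm2 /dot -!big_split; apply: eq_bigr => j _ /=.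
by rewrite !mxE; case: (e j) => //; rewrite -[RHS]mul1r -ac; ring.
Qed.

Lemma partial_phase_lift a c : a ^+ 2 + c ^+ 2 = 1 ->
  symplectic_lift (CP R N) (partial_phase e a c).
Proof.
move=> ac; split.
- by move=> a' c' u _; congr (_, _); apply/rowP => j; rewrite !mxE; case: (e j) => //=; ring.
- by move=> u /sphere_over_CP nu; apply/sphere_over_CP; rewrite cnorm2_partial_phase.
- move=> V X hX j; have [h1 h2] := hX j.
  have ec z : @elementary R V (fun=> z) := elementary_cst V z.
  split.
    rewrite (_ : (fun x => _) = fun x =>
      if e j then a * (X x).1 0 j - c * (X x).2 0 j else (X x).1 0 j).
      by case: (e j) => //; apply: elementaryB; apply: elementaryM.
    by apply/funext => x; rewrite mxE.
  rewrite (_ : (fun x => _) = fun x =>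
      if e j then c * (X x).1 0 j + a * (X x).2 0 j else (X x).2 0 j).
    by case: (e j) => //; apply: elementaryD; apply: elementaryM.
  by apply/funext => x; rewrite mxE.
exists (fun _ => partial_phase e a c); split.
  move=> g t v hg j; have [h1 h2] := hg j; split.
    rewrite (_ : (fun x => _) = fun x =>
      if e j then a * (g x).1 0 j - c * (g x).2 0 j else (g x).1 0 j).
      by rewrite mxE; case: (e j) => //; apply: is_deriveB_fun; apply: is_deriveMl_fun.
    by apply/funext => x; rewrite mxE.
  rewrite (_ : (fun x => _) = fun x =>
      if e j then c * (g x).1 0 j + a * (g x).2 0 j else (g x).2 0 j).
    by rewrite mxE; case: (e j) => //; apply: is_deriveD_fun; apply: is_deriveMl_fun.
  by apply/funext => x; rewrite mxE.
move=> _ v v'; rewrite /omega0 /dot -!sumrB; apply: eq_bigr => j _.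
by rewrite !mxE; case: (e j) => //; rewrite -[RHS]mul1r -ac; ring.
Qed.

(** Multiplication by i on the coordinates in [e] and zero on the others, where A^3 = -A still holds
    but A^2 = -1 fails. *)
Definition phase_generator u : realC R N.+1 :=
  (\row_j (if e j then - u.2 0 j else 0), \row_j (if e j then u.1 0 j else 0)).

Lemma generated_phase t u :
  generated_rotation phase_generator t u = partial_phase e (cos t) (sin t) u.
Proof. by congr (_, _); apply/rowP => j; rewrite !mxE; case: (e j) => //=; ring. Qed.

Lemma phase_generatorP : rotation_generator (CP R N) phase_generator.
Proof.
split.
- by move=> a u v; congr (_, _); apply/rowP => j; rewrite !mxE; case: (e j) => //=; ring.
- by move=> u; congr (_, _); apply/rowP => j; rewrite !mxE; case: (e j) => //=; ring.
- by move=> a c u; congr (_, _); apply/rowP => j; rewrite !mxE; case: (e j) => //=; ring.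
- move=> u v; rewrite /omega0 /dot -!sumrB; apply: eq_bigr => j _.
  by rewrite !mxE; case: (e j) => //=; ring.
- move=> V X hX j; have [h1 h2] := hX j; split.
    rewrite (_ : (fun x => _) = fun x => if e j then - (X x).2 0 j else 0).
      by case: (e j); [exact: elementaryN|exact: elementary_cst].
    by apply/funext => x; rewrite mxE.
  rewrite (_ : (fun x => _) = fun x => if e j then (X x).1 0 j else 0).
    by case: (e j); [|exact: elementary_cst].
  by apply/funext => x; rewrite mxE.
- move=> g t v hg j; have [h1 h2] := hg j; split.
    rewrite (_ : (fun x => _) = fun x => if e j then - (g x).2 0 j else 0).
      by rewrite mxE; case: (e j); [exact: is_deriveN|exact: is_derive_cst].
    by apply/funext => x; rewrite mxE.
  rewrite (_ : (fun x => _) = fun x => if e j then (g x).1 0 j else 0).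
    by rewrite mxE; case: (e j); [|exact: is_derive_cst].
  by apply/funext => x; rewrite mxE.
move=> t u /sphere_over_CP nu; apply/sphere_over_CP.
by rewrite generated_phase cnorm2_partial_phase // cos2Dsin2.
Qed.

End PartialPhase.

Section PlaneRotation.
Variables (i0 i1 : 'I_N.+1) (i01 : i0 != i1).

Definition plane_generator1 (x : 'rV[R]_N.+1) : 'rV[R]_N.+1 :=
  \row_j (if j == i0 then - x 0 i1 else if j == i1 then x 0 i0 else 0).

Definition plane_generator u : realC R N.+1 := (plane_generator1 u.1, plane_generator1 u.2).

Lemma dot_plane_generator1 x y : dot (plane_generator1 x) y = x 0 i0 * y 0 i1 - x 0 i1 * y 0 i0.
Proof.
rewrite /dot (bigD1 i0) //= (bigD1 i1) 1?eq_sym //= !mxE eqxx [i1 == i0]eq_sym (negbTE i01) eqxx.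
rewrite big1 => [|j /andP[/negbTE j0 /negbTE j1]]; first by ring.
by rewrite mxE j0 j1 mul0r.
Qed.

Lemma plane_generator1_cube x :
  plane_generator1 (plane_generator1 (plane_generator1 x)) = - plane_generator1 x.
Proof.
apply/rowP => j; rewrite !mxE !eqxx [i1 == i0]eq_sym (negbTE i01) /=.
by case: (j == i0) => //; case: (j == i1); rewrite ?oppr0.
Qed.

(** The exponential of a skew matrix is orthogonal: skewness and A^3 = -A reduce the difference of
    the sides to a multiple of 1 - sin^2 - cos^2. *)
Lemma dot_generated_plane t (x y : 'rV[R]_N.+1) :
  dot (x + sin t *: plane_generator1 x + (1 - cos t) *: plane_generator1 (plane_generator1 x))
      (y + sin t *: plane_generator1 y + (1 - cos t) *: plane_generator1 (plane_generator1 y))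
  = dot x y.
Proof.
have skew z z' : mdot predT (plane_generator1 z) z' = - mdot predT z (plane_generator1 z').
  by rewrite (mdotC _ z) -!dot_mdot !dot_plane_generator1; ring.
have c2 : cos t ^+ 2 = 1 - sin t ^+ 2 by rewrite -(cos2Dsin2 t); ring.
have cube z : mdot predT x (plane_generator1 (plane_generator1 (plane_generator1 z)))
    = - mdot predT x (plane_generator1 z).
  by rewrite plane_generator1_cube -[- _]scaleN1r mdotZr mulN1r.
rewrite !dot_mdot !(mdotDl, mdotDr, mdotZl, mdotZr) !skew !cube.
set q := mdot predT x (plane_generator1 (plane_generator1 y)).
transitivity (mdot predT x y + (1 - sin t ^+ 2 - cos t ^+ 2) * q); first by ring.
by rewrite c2; ring.
Qed.

Lemma plane_generatorP : rotation_generator (quadric R N) plane_generator.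
Proof.
split.
- by move=> a u v; congr (_, _); apply/rowP => j; rewrite !mxE;
    (case: (j == i0); [|case: (j == i1)]) => //=; ring.
- by move=> u; rewrite /plane_generator /= !plane_generator1_cube.
- by move=> a c u; congr (_, _); apply/rowP => j; rewrite !mxE;
    (case: (j == i0); [|case: (j == i1)]) => //=; ring.
- by move=> u v; rewrite /omega0 /= !dot_plane_generator1; ring.
- move=> V X hX j.
  have ec z : @elementary R V (fun=> z) := elementary_cst V z.
  split.
    rewrite (_ : (fun x => _) = fun x =>
      if j == i0 then - (X x).1 0 i1 else if j == i1 then (X x).1 0 i0 else 0).
      case: (j == i0); first by apply: elementaryN; exact: (hX i1).1.
      by case: (j == i1) => //; exact: (hX i0).1.
    by apply/funext => x; rewrite mxE.
  rewrite (_ : (fun x => _) = fun x =>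
      if j == i0 then - (X x).2 0 i1 else if j == i1 then (X x).2 0 i0 else 0).
    case: (j == i0); first by apply: elementaryN; exact: (hX i1).2.
    by case: (j == i1) => //; exact: (hX i0).2.
  by apply/funext => x; rewrite mxE.
- move=> g t v hg j; split.
    rewrite (_ : (fun x => _) = fun x =>
      if j == i0 then - (g x).1 0 i1 else if j == i1 then (g x).1 0 i0 else 0).
      rewrite mxE; case: (j == i0); first by apply: is_deriveN; exact: (hg i1).1.
      by case: (j == i1); [exact: (hg i0).1|exact: is_derive_cst].
    by apply/funext => x; rewrite mxE.
  rewrite (_ : (fun x => _) = fun x =>
      if j == i0 then - (g x).2 0 i1 else if j == i1 then (g x).2 0 i0 else 0).
    rewrite mxE; case: (j == i0); first by apply: is_deriveN; exact: (hg i1).2.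
    by case: (j == i1); [exact: (hg i0).2|exact: is_derive_cst].
  by apply/funext => x; rewrite mxE.
move=> t u /sphere_over_quadric [h1 h2 h3]; apply/sphere_over_quadric.
by rewrite /generated_rotation /= !dot_generated_plane.
Qed.

End PlaneRotation.

End Sphere.
End Lifts.

(** * Displacement in the projective space *)

Section Blocks.
Context {R : realType}.

Lemma dot_row_mx n1 n2 (a c : 'rV[R]_n1) (b d : 'rV[R]_n2) :
  dot (row_mx a b) (row_mx c d) = dot a c + dot b d.
Proof.
rewrite /dot big_split_ord; congr (_ + _); apply: eq_bigr => j _.
  by rewrite !row_mxEl.
by rewrite !row_mxEr.
Qed.

Lemma dotZZ n (a b : R) (x : 'rV[R]_n) : dot x x = 1 -> dot (a *: x) (b *: x) = a * b.
Proof. by move=> x1; rewrite dot_mdot mdotZl mdotZr -dot_mdot x1 mulr1. Qed.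

Lemma usphere_dot n (x : 'rV[R]_n.+1) : usphere R n x -> dot x x = 1.
Proof.
rewrite /usphere /= /enorm => h; have := mdot_ge0 predT x; rewrite -dot_mdot => x0.
by rewrite -(sqr_sqrtr x0) h expr1n.
Qed.

Section TwoBlocks.
Variables (k m : nat) (x : 'rV[R]_k.+1) (y : 'rV[R]_m.+1).
Hypotheses (x1 : dot x x = 1) (y1 : dot y y = 1).

(** The vector (u x, v y) with u = a + i a' and v = b + i b'. For fixed [x] and [y] these vectors
    represent the reduced CP^1 of the points [u : v], which the twist and the partial phases
    preserve. *)
Definition two_blocks (a b a' b' : R) : realC R (k.+1 + m.+1) :=
  (row_mx (a *: x) (b *: y), row_mx (a' *: x) (b' *: y)).

Definition left_block : pred 'I_(k.+1 + m.+1) := fun j => (j < k.+1)%N.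

Lemma partial_phase_two_blocks c s a b a' b' :
  partial_phase left_block c s (two_blocks a b a' b') =
  two_blocks (c * a - s * a') b (s * a + c * a') b'.
Proof.
congr (_, _); apply/rowP => j; rewrite mxE; case: (split_ordP j) => i ->;
  rewrite /left_block /= ?ltn_ord ?(ltnNge _ k.+1) ?leq_addr /= ?row_mxEl ?row_mxEr ?mxE //; ring.
Qed.

Lemma mdot_two_blocks a b a' b' :
  mdot predT (row_mx (a *: x) (b *: y)) (row_mx (a' *: x) (b' *: y)) = a * a' + b * b'.
Proof. by rewrite -dot_mdot dot_row_mx !dotZZ. Qed.

Lemma gram_two_blocks a b a' b' :
  gram predT (two_blocks a b a' b') = (a * b' - a' * b) ^+ 2.
Proof. by rewrite /gram /two_blocks /= !mdot_two_blocks; ring. Qed.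

Lemma twist_two_blocks h a b a' b' :
  let l := a * b' - a' * b in let w := (Num.sqrt (1 + h ^+ 2 * l ^+ 2))^-1 in
  twist predT h (two_blocks a b a' b') =
  two_blocks (w * (a + h * l * b)) (w * (b - h * l * a))
    (w * (a' + h * l * b')) (w * (b' - h * l * a')).
Proof.
rewrite /= -gram_two_blocks -/(twist_scale predT h (two_blocks a b a' b')).
rewrite [LHS]/twist /= !mdot_two_blocks.
by congr (_, _); apply/rowP => j; rewrite mxE; case: (split_ordP j) => i ->;
  rewrite ?row_mxEl ?row_mxEr ?mxE; ring.
Qed.

(** Here [d], [l] and (|u|^2 - |v|^2) / 2 are the Hopf coordinates of [u : v]. The untwist rotates
    the sphere about the [l]-axis by an angle with cosine (4 - l^2) / (4 + l^2) and sine of modulus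
    4 |l| / (4 + l^2); the partial phase then moves the [d]-axis to the [l]-axis, whose squared
    coordinate is [gram]. *)
Lemma gram_untwist a b a' b' :
  let l := a * b' - a' * b in let d := a * b + a' * b' in
  gram predT (partial_phase left_block 0 (-1)
    (twist predT (- 2^-1) (two_blocks a b a' b'))) * (4 + l ^+ 2) ^+ 2 =
  ((4 - l ^+ 2) * d + 4 * l * ((a ^+ 2 + a' ^+ 2 - b ^+ 2 - b' ^+ 2) / 2)) ^+ 2.
Proof.
move=> l d; rewrite twist_two_blocks partial_phase_two_blocks gram_two_blocks -/l.
set w := (Num.sqrt _)^-1.
have w2 : w ^+ 2 * (4 + l ^+ 2) = 4.
  have p0 : 0 < 1 + (- 2^-1) ^+ 2 * l ^+ 2 by rewrite ltr_wpDr ?ltr01 // mulr_ge0 ?sqr_ge0.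
  rewrite exprVn sqr_sqrtr ?(ltW p0) // sqrrN.
  have -> : 4 + l ^+ 2 = 4 * (1 + 2^-1 ^+ 2 * l ^+ 2) by field.
  by rewrite mulrCA mulVf ?mulr1 // -(sqrrN (2^-1 : R)) gt_eqF.
set A := (X in X ^+ 2 * _).
have -> : A = w ^+ 2 * (d * (1 - l ^+ 2 / 4) + l * ((a ^+ 2 + a' ^+ 2 - b ^+ 2 - b' ^+ 2) / 2)).
  by rewrite /A /d; field.
rewrite -exprMn mulrAC w2; congr (_ ^+ 2); by field.
Qed.

End TwoBlocks.

Lemma cnorm2_two_blocks k m (x : 'rV[R]_k.+1) (y : 'rV[R]_m.+1) a b a' b' :
  dot x x = 1 -> dot y y = 1 ->
  cnorm2 (two_blocks x y a b a' b') = a ^+ 2 + b ^+ 2 + a' ^+ 2 + b' ^+ 2.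
Proof. by move=> x1 y1; rewrite /cnorm2 /= !dot_row_mx !dotZZ //; ring. Qed.

(** With s^2 = f(r) and z^2 = 1 - r^2, the squared norm is s^2 r^2 + s^-2 = (1 - z) + (1 + z) = 2.
    The factors s and 1/s cancel in [a * b' - a' * b], which equals -r. Positivity of r selects the
    branch of [fP] away from 0. *)
Lemma LP_two_blocks k m (P : set 'rV[R[i]]_(k.+1 + m.+1)) :
  0 < 1 - 2 / (k + m + 2)%:R :> R -> LP R k m P ->
  exists x y a b a' b', [/\ dot x x = 1, dot y y = 1,
    P = hpt (cvec (two_blocks (k := k) (m := m) x y a b a' b')),
    a ^+ 2 + b ^+ 2 + a' ^+ 2 + b' ^+ 2 = 2 &
    (a * b' - a' * b) ^+ 2 = (1 - 2 / (k + m + 2)%:R) ^+ 2].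
Proof.
move=> r0 [_ [pq [t [x [y [/usphere_dot x1 /usphere_dot y1 ->]]]] <-] <-].
set r := 1 - _ in r0 *.
have r1 : r < 1 by rewrite ltrBlDr ltrDl divr_gt0 // ltr0n addn2.
rewrite PsiP_pi /PsiP_rep /=.
have cs := cos2Dsin2 t.
have -> : enorm (row_mx (- r * sin t *: x) (r * cos t *: y)) = r.
  rewrite /enorm dot_row_mx !dotZZ // -[RHS](ger0_norm (ltW r0)) -sqrtr_sqr; congr Num.sqrt.
  by rewrite -[RHS]mulr1 -cs; ring.
rewrite /fP gt_eqF //; set z := Num.sqrt (1 - r ^+ 2).
have z2 : z ^+ 2 = 1 - r ^+ 2 by rewrite sqr_sqrtr // subr_ge0 expr_le1 // ltW.
have z0 : 0 <= z by exact: sqrtr_ge0.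
have z1 : z < 1 by rewrite -(@ltr_pXn2r _ 2) ?nnegrE // z2 expr1n ltrBlDr ltrDl exprn_gt0.
have f0 : 0 < (1 - z) / r ^+ 2 by rewrite divr_gt0 ?subr_gt0 // exprn_gt0.
set s := Num.sqrt _.
have s2 : s ^+ 2 = (1 - z) / r ^+ 2 by rewrite sqr_sqrtr // ltW.
have s0 : s != 0 by rewrite gt_eqF // sqrtr_gt0.
exists x, y, (s * (- r * sin t)), (s * (r * cos t)), (s^-1 * cos t), (s^-1 * sin t); split=> //.
- by congr (hpt (cvec (_, _))); rewrite scale_row_mx !scalerA.
- transitivity ((s ^+ 2 * r ^+ 2 + (s ^+ 2)^-1) * (cos t ^+ 2 + sin t ^+ 2)); first by field.
  have r20 : r != 0 by rewrite gt_eqF.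
  have z10 : 1 - z != 0 by rewrite gt_eqF // subr_gt0.
  rewrite cs s2 mulr1 divfK ?expf_neq0 // invf_div.
  have -> : r ^+ 2 = (1 - z) * (1 + z) by rewrite -[r ^+ 2](subKr 1) -z2; ring.
  by field.
- transitivity ((r * (cos t ^+ 2 + sin t ^+ 2)) ^+ 2); first by field.
  by rewrite cs mulr1.
Qed.

End Blocks.

Section Displacements.
Context {R : realType}.

Lemma LP_displaceable k m : (3 <= k + m)%N -> displaceable (CP R (k + m.+1)) (LP R k m).
Proof.
move=> km.
(* Equality holds for k + m = 3, so this case needs the full strength of [caps_disjoint]. *)
have r35 : 3 / 5 <= 1 - 2 / (k + m + 2)%:R :> R.
  have : (5 : R) <= (k + m + 2)%:R by rewrite ler_nat; lia.
  move=> h5; have p0 : 0 < (k + m + 2)%:R :> R by apply: lt_le_trans h5; rewrite ltr0n.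
  have : 2 / (k + m + 2)%:R <= 2 / 5 :> R by rewrite ler_pM2l // lef_pV2 // posrE ltr0n.
  lra.
have r0 : 0 < 1 - 2 / (k + m + 2)%:R :> R by lra.
have ac1 : 0 ^+ 2 + 1 ^+ 2 = 1 :> R by rewrite expr0n expr1n add0r.
have ac2 : 0 ^+ 2 + (- 1) ^+ 2 = 1 :> R by rewrite sqrrN.
set e := @left_block k m.
(* Multiplying the left block by i exchanges the Hopf coordinates [l] and [d] up to sign: the
   Lagrangian, originally over |l| = r, moves to |d| = r before the twist about the [l]-axis. *)
have hJ := @partial_phase_lift R (k + m.+1) e 0 1 ac1.
have hJ' := @partial_phase_lift R (k + m.+1) e 0 (-1) ac2.
have JK u : partial_phase e 0 (-1) (partial_phase e (0 : R) 1 u) = u.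
  rewrite [RHS]surjective_pairing; congr (_, _); apply/rowP => j;
    rewrite !mxE; case: (e j) => //; ring.
have J'K u : partial_phase e 0 1 (partial_phase e (0 : R) (-1) u) = u.
  rewrite [RHS]surjective_pairing; congr (_, _); apply/rowP => j;
    rewrite !mxE; case: (e j) => //; ring.
have hF := symplectic_lift_comp (@twist_lift_CP R (k + m.+1) predT 2^-1) hJ.
have hG := symplectic_lift_comp hJ' (@twist_lift_CP R (k + m.+1) predT (- 2^-1)).
apply: (conjugated_rotation_displaces _ hF hG _ _ (@phase_generatorP R (k + m.+1) e)) => //.
- by move=> u /=; rewrite twistK JK.
- by move=> u /=; rewrite J'K -{1}(opprK 2^-1) twistK.
- move=> P /(LP_two_blocks r0) [x [y [a [b [a' [b' [x1 y1 -> nu _]]]]]]].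
  by have [_] := (@sphere_over_CP R (k + m.+1) (two_blocks x y a b a' b')).2
    (etrans (cnorm2_two_blocks _ _ _ _ x1 y1) nu).
move=> u hu /(LP_two_blocks r0) [x [y [a [b [a' [b' [x1 y1 uE nu lr]]]]]]].
have nu0 := etrans (cnorm2_two_blocks a b a' b' x1 y1) nu.
(* The lift [u] is the two-block representative up to a phase, which passes through all the maps. *)
have [c [s [cs ->]]] := hpt_eq_phase hu.1 nu0 uE.
rewrite generated_phase cos_pihalf sin_pihalf -/e.
rewrite (lift_phase hF) // (lift_phase hJ) // (lift_phase hG) // hpt_phase //.
set F := twist predT 2^-1 \o _; set G := _ \o twist predT (- 2^-1).
move=> /(LP_two_blocks r0) [x' [y' [A [B [A' [B' [x1' y1' uE' nu' lr']]]]]]].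
have sphere u0 : cnorm2 u0 = 2 -> cnorm2 (G (partial_phase e 0 1 (F u0))) = 2.
  move=> h0; have h1 := (@sphere_over_CP R (k + m.+1) u0).2 h0.
  exact: (lift_sphere hG (lift_sphere hJ (lift_sphere hF h1))).1.
have [c' [s' [cs' E]]] := hpt_eq_phase (sphere _ nu0)
  (etrans (cnorm2_two_blocks A B A' B' x1' y1') nu') uE'.
have g1 : gram predT (G (partial_phase e 0 1 (F (two_blocks x y a b a' b')))) =
    (1 - 2 / (k + m + 2)%:R) ^+ 2.
  rewrite E; have [_ _ _ ->] := mdot_phase predT (two_blocks x' y' A B A' B') cs'.
  by rewrite gram_two_blocks.
have g2 : gram predT (G (F (two_blocks x y a b a' b'))) = (1 - 2 / (k + m + 2)%:R) ^+ 2.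
  by rewrite /G /F /= twistK JK gram_two_blocks.
have [a1 [b1 [a1' [b1' FE]]]] : exists a1 b1 a1' b1',
    F (two_blocks x y a b a' b') = two_blocks x y a1 b1 a1' b1'.
  by rewrite /F /= partial_phase_two_blocks // twist_two_blocks //; do 4 eexists.
have nF : a1 ^+ 2 + b1 ^+ 2 + a1' ^+ 2 + b1' ^+ 2 = 2.
  rewrite -(cnorm2_two_blocks a1 b1 a1' b1' x1 y1) -FE.
  exact: (lift_sphere hF ((@sphere_over_CP R (k + m.+1) _).2 nu0)).1.
rewrite FE partial_phase_two_blocks // in g1; rewrite FE in g2.
(* [H2] concerns the twisted point and [H1] its quarter-turn, which takes (d, l) to (l, -d) and
   fixes the third Hopf coordinate. *)
have H2 := gram_untwist x1 y1 a1 b1 a1' b1'.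
have H1 := gram_untwist x1 y1 (0 * a1 - 1 * a1') b1 (1 * a1 + 0 * a1') b1'.
rewrite /G /= in g1 g2; rewrite g2 /= in H2; rewrite g1 /= in H1.
apply: (@caps_disjoint _ (a1 * b1 + a1' * b1') (a1 * b1' - a1' * b1)
  ((a1 ^+ 2 + a1' ^+ 2 - b1 ^+ 2 - b1' ^+ 2) / 2) _ _ r35).
- transitivity (((a1 ^+ 2 + b1 ^+ 2 + a1' ^+ 2 + b1' ^+ 2) / 2) ^+ 2); first by field.
  by rewrite nF divff ?pnatr_eq0 // expr1n.
- by rewrite exprMn H2.
- rewrite exprMn; move: H1; set rr := _ ^+ 2.
  have -> : 4 + ((0 * a1 - 1 * a1') * b1' - (1 * a1 + 0 * a1') * b1) ^+ 2 =
    4 + (a1 * b1 + a1' * b1') ^+ 2 by ring.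
  by move=> ->; congr (_ ^+ 2); field.
Qed.

End Displacements.

(** * Displacement in the quadric *)

Section Quadric.
Context {R : realType} (m : nat).

Section ThreeBlocks.
Variable y : 'rV[R]_m.+1.
Hypothesis y1 : dot y y = 1.

Definition three_blocks1 (a b c : R) : 'rV[R]_(1 + (1 + m.+1)) :=
  row_mx a%:M (row_mx b%:M (c *: y)).

(** For fixed [y], the orthonormal pairs of this form are oriented planes in the R^3 spanned by the
    first two coordinate vectors and [y]; the 2 x 2 minors are, up to sign, the coordinates of the
    unit normal. *)
Definition three_blocks (a b c a' b' c' : R) : realC R (1 + (1 + m.+1)) :=
  (three_blocks1 a b c, three_blocks1 a' b' c').

Definition block0 : 'I_(1 + (1 + m.+1)) := lshift _ ord0.
Definition block1 : 'I_(1 + (1 + m.+1)) := rshift 1 (lshift _ ord0).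

(** Leaving out this coordinate makes the twist a rotation of R^3 about its axis. *)
Definition off_block1 : pred 'I_(1 + (1 + m.+1)) := fun j => j != block1.

Lemma block_neq : block0 != block1.
Proof. by rewrite eq_lrshift. Qed.

Lemma scalar_mx1E (a : R) (i : 'I_1) : (a%:M : 'rV[R]_1) 0 i = a.
Proof. by rewrite mxE !ord1 eqxx mulr1n. Qed.

Lemma three_blocks10 a b c : three_blocks1 a b c 0 block0 = a.
Proof. by rewrite row_mxEl scalar_mx1E. Qed.

Lemma three_blocks11 a b c : three_blocks1 a b c 0 block1 = b.
Proof. by rewrite row_mxEr row_mxEl scalar_mx1E. Qed.

Lemma three_blocks12 a b c j : three_blocks1 a b c 0 (rshift 1 (rshift 1 j)) = c * y 0 j.
Proof. by rewrite !row_mxEr mxE. Qed.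

Lemma three_blocks1_ext (x : 'rV[R]_(1 + (1 + m.+1))) a b c :
  x 0 block0 = a -> x 0 block1 = b ->
  (forall j, x 0 (rshift 1 (rshift 1 j)) = c * y 0 j) -> x = three_blocks1 a b c.
Proof.
move=> h0 h1 h2; apply/rowP => j; case: (split_ordP j) => i ->.
  by rewrite row_mxEl scalar_mx1E ord1.
rewrite row_mxEr; case: (split_ordP i) => l ->; first by rewrite row_mxEl scalar_mx1E ord1.
by rewrite row_mxEr mxE h2.
Qed.

Lemma dot_three_blocks a b c a' b' c' :
  dot (three_blocks1 a b c) (three_blocks1 a' b' c') = a * a' + (b * b' + c * c').
Proof.
rewrite !dot_row_mx dotZZ // /dot !big_ord1.
by rewrite !mxE !eqxx !mulr1n.
Qed.

Lemma mdot_three_blocks a b c a' b' c' :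
  mdot off_block1 (three_blocks1 a b c) (three_blocks1 a' b' c') = a * a' + c * c'.
Proof.
apply: (addIr (b * b')); transitivity (dot (three_blocks1 a b c) (three_blocks1 a' b' c')).
  rewrite (dot_split off_block1); congr (_ + _); rewrite /mdot (big_pred1 block1) ?three_blocks11 //.
  by move=> j; rewrite /= negbK.
by rewrite dot_three_blocks; ring.
Qed.

Lemma gram_three_blocks a b c a' b' c' :
  gram off_block1 (three_blocks a b c a' b' c') = (a * c' - a' * c) ^+ 2.
Proof. by rewrite /gram /three_blocks /= !mdot_three_blocks; ring. Qed.

Lemma twist_three_blocks h a b c a' b' c' :
  let l := a * c' - a' * c in let w := (Num.sqrt (1 + h ^+ 2 * l ^+ 2))^-1 in
  twist off_block1 h (three_blocks a b c a' b' c') =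
  three_blocks (w * (a + h * l * c)) b (w * (c - h * l * a))
    (w * (a' + h * l * c')) b' (w * (c' - h * l * a')).
Proof.
rewrite /= -(gram_three_blocks a b c a' b' c') -/(twist_scale off_block1 h (three_blocks a b c a' b' c')).
set w := twist_scale _ _ _.
rewrite [LHS]/twist /= !mdot_three_blocks -/w.
have e2 j : off_block1 (rshift 1 (rshift 1 j)) = true.
  by rewrite /off_block1 /block1 (inj_eq (@rshift_inj 1 _)) eq_rlshift.
have e0 : off_block1 block0 = true by exact: block_neq.
have e1 : off_block1 block1 = false by rewrite /off_block1 eqxx.
by congr (_, _); apply: three_blocks1_ext => [||j]; rewrite mxE ?e0 ?e1 ?e2
  ?three_blocks10 ?three_blocks11 // ?row_mxEr ?mxE; ring.
Qed.

Lemma plane_generator1_three_blocks a b c :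
  @plane_generator1 R (1 + m.+1) block0 block1 (three_blocks1 a b c) = three_blocks1 (- b) a 0.
Proof.
have n1 : (block1 == block0) = false by rewrite eq_sym (negbTE block_neq).
have n2 (j : 'I_m.+1) : (rshift 1 (rshift 1 j) == block0) = false by rewrite /block0 eq_rlshift.
have n3 (j : 'I_m.+1) : (rshift 1 (rshift 1 j) == block1) = false.
  by rewrite /block1 (inj_eq (@rshift_inj 1 _)) eq_rlshift.
apply: three_blocks1_ext => [||j]; rewrite mxE.
- by rewrite eqxx three_blocks11.
- by rewrite n1 eqxx three_blocks10.
by rewrite n2 n3 mul0r.
Qed.

Lemma generated_plane_three_blocks a b c a' b' c' :
  generated_rotation (@plane_generator R (1 + m.+1) block0 block1) (pi / 2)
    (three_blocks a b c a' b' c') = three_blocks (- b) a c (- b') a' c'.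
Proof.
rewrite /generated_rotation cos_pihalf sin_pihalf subr0 !scale1r.
rewrite /plane_generator /= !plane_generator1_three_blocks.
have mxE_rot (x z t : 'rV[R]_(1 + (1 + m.+1))) i : (x + z + t) 0 i = x 0 i + z 0 i + t 0 i.
  by rewrite !mxE.
congr (_, _); apply: three_blocks1_ext => [||j];
  rewrite mxE_rot ?three_blocks10 ?three_blocks11 ?three_blocks12; ring.
Qed.

(** For an orthonormal pair in R^3, 1 - (a^2 + a'^2) is the square of the first coordinate
    [b * c' - b' * c] of the normal, and the two untwists together turn the normal by 2 arctan (l/2)
    up to sign. *)
Lemma untwist_block0 a b c a' b' c' :
  a * a + (b * b + c * c) = 1 -> a' * a' + (b' * b' + c' * c') = 1 ->
  a * a' + (b * b' + c * c') = 0 ->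
  let l := a * c' - a' * c in
  let u := twist off_block1 (- 2^-1) (twist off_block1 (- 2^-1) (three_blocks a b c a' b' c')) in
  (1 - (u.1 0 block0 ^+ 2 + u.2 0 block0 ^+ 2)) * (4 + l ^+ 2) ^+ 2 =
    ((4 - l ^+ 2) * (b * c' - b' * c) - 4 * l * (a * b' - a' * b)) ^+ 2.
Proof.
move=> h1 h2 h3 l u.
pose w := (Num.sqrt (1 + (- 2^-1) ^+ 2 * l ^+ 2))^-1.
have w2 : w ^+ 2 * (4 + l ^+ 2) = 4.
  have p0 : 0 < 1 + (- 2^-1) ^+ 2 * l ^+ 2 by rewrite ltr_wpDr ?ltr01 // mulr_ge0 ?sqr_ge0.
  rewrite exprVn sqr_sqrtr ?(ltW p0) // sqrrN.
  have -> : 4 + l ^+ 2 = 4 * (1 + 2^-1 ^+ 2 * l ^+ 2) by field.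
  by rewrite mulrCA mulVf ?mulr1 // -(sqrrN (2^-1 : R)) gt_eqF.
have l4 : 4 + l ^+ 2 != 0 by apply/eqP => z; move: w2; rewrite z mulr0 => /esym/eqP; rewrite pnatr_eq0.
have w2E : w ^+ 2 = 4 / (4 + l ^+ 2) by apply: (mulIf l4); rewrite w2 divfK.
have uE : u.1 0 block0 = w ^+ 2 * ((1 - l ^+ 2 / 4) * a - l * c) /\
  u.2 0 block0 = w ^+ 2 * ((1 - l ^+ 2 / 4) * a' - l * c').
  (* The first untwist keeps the minor [l], so the second has the same scale [w]. *)
  have lE : w * (a + - 2^-1 * l * c) * (w * (c' - - 2^-1 * l * a')) -
      w * (a' + - 2^-1 * l * c') * (w * (c - - 2^-1 * l * a)) = l.
    transitivity (w ^+ 2 * (4 + l ^+ 2) * (l / 4)); first by rewrite /l; field.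
    by rewrite w2; field.
  rewrite /u twist_three_blocks -/l -/w twist_three_blocks /= lE -/w !three_blocks10.
  by split; field.
have [-> ->] := uE; rewrite w2E.
have B : b * b = 1 - a * a - c * c by rewrite -h1; ring.
have B' : b' * b' = 1 - a' * a' - c' * c' by rewrite -h2; ring.
have BB : b * b' = - (a * a') - c * c' by apply/eqP; rewrite -subr_eq0 -h3; apply/eqP; ring.
transitivity ((4 + l ^+ 2) ^+ 2 - (4 - l ^+ 2) ^+ 2 * (a ^+ 2 + a' ^+ 2) 
   - 16 * l ^+ 2 * (c ^+ 2 + c' ^+ 2)
   + 8 * l * (4 - l ^+ 2) * (a * c + a' * c')); first by field.
(* The pair and its normal form an orthogonal matrix; [E1], [E2] and [E3] express the orthonormality
   of its first and third columns. *)
have E1 : (b * c' - b' * c) ^+ 2 = 1 - a ^+ 2 - a' ^+ 2.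
  transitivity ((b * b) * c' ^+ 2 - 2 * (b * b') * c * c' + (b' * b') * c ^+ 2); first by ring.
  have : (b * b') * (b * b') = (b * b) * (b' * b') by ring.
  by rewrite B B' BB; lra.
have E2 : (a * b' - a' * b) ^+ 2 = 1 - c ^+ 2 - c' ^+ 2.
  transitivity ((b' * b') * a ^+ 2 - 2 * (b * b') * a * a' + (b * b) * a' ^+ 2); first by ring.
  have : (b * b') * (b * b') = (b * b) * (b' * b') by ring.
  by rewrite B B' BB; lra.
have E3 : (b * c' - b' * c) * (a * b' - a' * b) = - (a * c + a' * c').
  transitivity ((a * c' + a' * c) * (b * b') - a' * c' * (b * b) - a * c * (b' * b')); first by ring.
  by rewrite B B' BB; ring.
transitivity ((4 - l ^+ 2) ^+ 2 * (b * c' - b' * c) ^+ 2 + 16 * l ^+ 2 * (a * b' - a' * b) ^+ 2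
  - 8 * l * (4 - l ^+ 2) * ((b * c' - b' * c) * (a * b' - a' * b))); last by ring.
by rewrite E1 E2 E3; ring.
Qed.

End ThreeBlocks.

Lemma LQ_three_blocks P : LQ R 0 m P -> exists (y : 'rV[R]_m.+1) b c a' b' c' a,
  [/\ dot y y = 1, P = hpt (cvec (three_blocks y a b c a' b' c')),
    sphere_over (quadric R m.+2) (three_blocks y a b c a' b' c') &
    1 - (a ^+ 2 + a' ^+ 2) = (1 - (m.+1)%:R^-1) ^+ 2].
Proof.
move=> [_ [t [x [y [/usphere_dot x1 /usphere_dot y1 ->]]]] <-].
rewrite /Psi add0n addn1 /=; set r : R := 1 - (m.+1)%:R^-1.
have cs := cos2Dsin2 t.
have r0 : 0 <= r by rewrite subr_ge0 invf_le1 ?ltr0n // ler1n.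
have r1 : r <= 1 by rewrite gerBl invr_ge0 ler0n.
have -> : enorm (row_mx (- r * sin t *: x) (r * cos t *: y)) = r.
  rewrite /enorm dot_row_mx !dotZZ // -[RHS](ger0_norm r0) -sqrtr_sqr; congr Num.sqrt.
  by rewrite -[RHS]mulr1 -cs; ring.
set z := Num.sqrt _.
have z2 : z ^+ 2 = 1 - r ^+ 2 by rewrite sqr_sqrtr // subr_ge0 expr_le1.
(* As k = 0, [x] is a 1 x 1 matrix with entry 1 or -1. *)
have xE (a : R) : a *: x = (a * x 0 0)%:M.
  by apply/rowP => j; rewrite !mxE ord1 eqxx mulr1n.
have x2 : x 0 0 * x 0 0 = 1 by move: x1; rewrite /dot big_ord1.
(* The last witness is the first homogeneous coordinate, sqrt (1 - |p|^2); it is real, hence a' =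
   0. *)
exists y, (- r * sin t * x 0 0), (r * cos t), 0, (cos t * x 0 0), (sin t), z; split=> //.
- congr hpt; apply/rowP => j; rewrite /three_blocks /three_blocks1 /=.
  case: (split_ordP j) => i ->.
    by rewrite [RHS]mxE /= !row_mxEl !scalar_mx1E mxE ord1 eqxx mulr1n.
  by rewrite row_mxEr [RHS]mxE /= !row_mxEr mxE !xE.
- apply/sphere_over_quadric; rewrite /= !dot_three_blocks //; split.
  + transitivity (z ^+ 2 + r ^+ 2 * (sin t ^+ 2 * (x 0 0 * x 0 0) + cos t ^+ 2)); first by ring.
    by rewrite x2 mulr1 addrC [sin t ^+ 2 + _]addrC cs z2; ring.
  + transitivity (cos t ^+ 2 * (x 0 0 * x 0 0) + sin t ^+ 2); first by ring.
    by rewrite x2 mulr1.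
  + transitivity (r * sin t * cos t * (1 - x 0 0 * x 0 0)); first by ring.
    by rewrite x2 subrr mulr0.
- by rewrite z2; ring.
Qed.

Lemma LQ_displaceable : (2 <= m)%N -> displaceable (quadric R m.+2) (LQ R 0 m).
Proof.
move=> m2.
have r35 : 3 / 5 <= 1 - (m.+1)%:R^-1 :> R.
  have : (m.+1)%:R^-1 <= 3^-1 :> R by rewrite lef_pV2 ?posrE ?ltr0n // ler_nat.
  by move=> h; rewrite lerBrDr; apply: le_trans (lerD (lexx _) h) _; lra.
set e := off_block1.
have hT b := @twist_lift_quadric R m.+2 e b.
(* Two twists are composed because one turns the normal only by arctan (l/2), whereas on the Hopf
   sphere the angle is doubled. *)
pose F := @twist R _ e 2^-1 \o twist e 2^-1; pose G := @twist R _ e (- 2^-1) \o twist e (- 2^-1).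
have hF : symplectic_lift (quadric R m.+2) F := symplectic_lift_comp (hT _) (hT _).
have hG : symplectic_lift (quadric R m.+2) G := symplectic_lift_comp (hT _) (hT _).
have hA := @plane_generatorP R m.+2 _ _ block_neq.
have FK : cancel F G by move=> u; rewrite /F /G /= !twistK.
apply: (conjugated_rotation_displaces (@quadric_sub_CP R m.+2) hF hG FK _ hA).
- by move=> u; rewrite /F /G /= -[X in twist e X (twist e X _)]opprK !twistK.
- by move=> P /LQ_three_blocks [y [b [c [a' [b' [c' [a [y1 -> [_ hu] _]]]]]]]].
move=> u hu /LQ_three_blocks [y [b [c [a' [b' [c' [a [y1 uE hu0 la]]]]]]]].
set u0 := three_blocks y a b c a' b' c' in uE hu0.
have [c1 [s1 [cs ->]]] := hpt_eq_phase hu.1 hu0.1 uE.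
have hR := generator_sphere hA (pi / 2).
have Rphase v : generated_rotation (plane_generator block0 block1) (pi / 2) (phase c1 s1 v) =
    phase c1 s1 (generated_rotation (plane_generator block0 block1) (pi / 2) v).
  by rewrite /generated_rotation !(generator_phase hA) !phaseD !phaseZ.
rewrite (lift_phase hF) // Rphase (lift_phase hG) // hpt_phase //.
move=> /LQ_three_blocks [z [B [C [A' [B' [C' [A [z1 vE hv0 lA]]]]]]]].
have hv := lift_sphere hG (hR _ (lift_sphere hF hu0)).
have [c2 [s2 [cs' E]]] := hpt_eq_phase hv.1 hv0.1 vE.
set v := G _ in E.
(* The modulus of the first coordinate is unchanged by the phase, so it can be read off the
   representative. *)
have g1 : 1 - (v.1 0 block0 ^+ 2 + v.2 0 block0 ^+ 2) = (1 - (m.+1)%:R^-1) ^+ 2.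
  have p1 (x : realC R m.+3) j : (phase c2 s2 x).1 0 j = c2 * x.1 0 j - s2 * x.2 0 j by rewrite !mxE.
  have p2 (x : realC R m.+3) j : (phase c2 s2 x).2 0 j = s2 * x.1 0 j + c2 * x.2 0 j by rewrite !mxE.
  rewrite E -lA p1 p2 !three_blocks10; congr (1 - _).
  by rewrite -[RHS]mul1r -cs'; ring.
have [a1 [b1 [d1 [a1' [b1' [d1' FE]]]]]] : exists a1 b1 d1 a1' b1' d1',
    F u0 = three_blocks y a1 b1 d1 a1' b1' d1'.
  by rewrite /F /= !twist_three_blocks //; do 6 eexists.
have g2 : 1 - ((G (F u0)).1 0 block0 ^+ 2 + (G (F u0)).2 0 block0 ^+ 2) = (1 - (m.+1)%:R^-1) ^+ 2.
  by rewrite FK /u0 !three_blocks10.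
have := lift_sphere hF hu0; rewrite FE => /sphere_over_quadric.
rewrite /= !dot_three_blocks // => -[h1 h2 h3].
rewrite /v FE generated_plane_three_blocks // in g1; rewrite FE in g2.
have H u1 u2 u3 u1' u2' u3' (l := u1 * u3' - u1' * u3) 
    (q := G (three_blocks y u1 u2 u3 u1' u2' u3')) :
  u1 * u1 + (u2 * u2 + u3 * u3) = 1 -> u1' * u1' + (u2' * u2' + u3' * u3') = 1 ->
  u1 * u1' + (u2 * u2' + u3 * u3') = 0 ->
  1 - (q.1 0 block0 ^+ 2 + q.2 0 block0 ^+ 2) = (1 - m.+1%:R^-1) ^+ 2 ->
  (1 - m.+1%:R^-1) ^+ 2 * (4 + l ^+ 2) ^+ 2 =
    ((4 - l ^+ 2) * (u2 * u3' - u2' * u3) - 4 * l * (u1 * u2' - u1' * u2)) ^+ 2.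
  by move=> e1 e2 e3 <-; exact: untwist_block0.
have H2 := H _ _ _ _ _ _ h1 h2 h3 g2.
have h1' : - b1 * - b1 + (a1 * a1 + d1 * d1) = 1 by rewrite -h1; ring.
have h2' : - b1' * - b1' + (a1' * a1' + d1' * d1') = 1 by rewrite -h2; ring.
have h3' : - b1 * - b1' + (a1 * a1' + d1 * d1') = 0 by rewrite -h3; ring.
have H1 := H _ _ _ _ _ _ h1' h2' h3' g1.
(* These are the coordinates of the normal up to a common choice of signs; the rotation turns the
   first two by a quarter and fixes the third. *)
apply: (@caps_disjoint _ (b1 * d1' - b1' * d1) (a1 * d1' - a1' * d1)
  (- (a1 * b1' - a1' * b1)) _ _ r35).
- have D : (a1 * d1' - a1' * d1) ^+ 2 =
    (a1 * a1 + d1 * d1) * (a1' * a1' + d1' * d1') - (a1 * a1' + d1 * d1') ^+ 2 by ring.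
  (* By the identity of Lagrange, the normal of an orthonormal pair has unit length. *)
  transitivity ((a1 * a1 + (b1 * b1 + d1 * d1)) * (a1' * a1' + (b1' * b1' + d1' * d1'))
    - (a1 * a1' + (b1 * b1' + d1 * d1')) ^+ 2); first by ring.
  by rewrite h1 h2 h3; ring.
- by rewrite [RHS]exprMn H2; congr (_ ^+ 2); ring.
- rewrite [RHS]exprMn.
  have -> : 4 + (b1 * d1' - b1' * d1) ^+ 2 = 4 + (- b1 * d1' - - b1' * d1) ^+ 2 by ring.
  by rewrite H1; congr (_ ^+ 2); ring.
Qed.

End Quadric.

Local Close Scope complex_scope.
Local Close Scope ring_scope.
Local Close Scope classical_set_scope.

Theorem theorem1p4 (R : realType) (k m : nat) (hkm : (k <= m)%N)
    (hm : (1 <= m)%N) :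
  ((2 <= m)%N -> displaceable (quadric R m.+2) (LQ R 0 m)) /\
  ((3 <= k + m)%N -> displaceable (CP R (k + m.+1)) (LP R k m)).
Proof. by split; [exact: LQ_displaceable|exact: LP_displaceable]. Qed.
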